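(* Let $\varepsilon>0$ be a constant and suppose $p=p_n$ eventually satisfies $n^{-1/3+\varepsilon}\le p\le 1-\varepsilon$. Let $f(n,k,p)=\binom{n}{k}(1-(1-p)^k)^{n-k}$ and $r=r_n=\min\{k\in\mathbb{N}: f(n,k,p)>1/(pn)\}$. Suppose there exist an infinite set $I'\subseteq\mathbb{N}$ and a sequence $\omega=\omega_n\to\infty$ such that $$f(n,r,p)\ge\exp(\omega\log n)\qquad\text{for } n\in I'.$$ Then, with asymptotics restricted to $n\in I'$, asymptotically almost surely $\gamma(\mathcal{G}(n,p))=r$. Moreover, suppose that the set $I=\{n\in\mathbb{N}: n\in I',\ n-1\in I'\}$ is infinite. Then, with asymptotics restricted to $n\in I$, asymptotically almost surely $$b(\mathcal{G}(n,p))=\Theta(\Delta(\mathcal{G}(n,p)))=\Theta(pn).$$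
   Context: $\mathcal{G}(n,p)$ is the binomial random graph on vertex set $[n]$ in which each pair is an edge independently with probability $p$. Note $f(n,k,p)$ is the expected number of dominating sets of size $k$ in $\mathcal{G}(n,p)$. A dominating set of $G=(V,E)$ is a set $D\subseteq V$ such that every vertex not in $D$ has a neighbour in $D$; $\gamma(G)$ is the minimum size of a dominating set. The bondage number of a graph with at least one edge is $b(G)=\min\{|B|: B\subseteq E,\ \gamma(G-B)>\gamma(G)\}$. $\Delta(G)$ is the maximum degree. ''With asymptotics restricted to $n\in J$, a.a.s.'' means the probability tends to $1$ as $n\to\infty$ along $n\in J$. ''Eventually'' means for all but finitely many $n$. Functions hidden in $\Theta(\cdot)$ are positive. Logarithms are natural. *)

(* Defs.v *)
From HB Require Import structures.
From mathcomp Require Import all_boot all_order all_algebra.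
From mathcomp Require Import all_classical all_reals all_analysis.

Set Implicit Arguments.
Unset Strict Implicit.
Unset Printing Implicit Defensive.

Import Order.TTheory GRing.Theory Num.Theory.
Import numFieldNormedType.Exports.

Local Open Scope classical_set_scope.
Local Open Scope ring_scope.

(* A graph on the vertex type V is given by its edge set: a subset of
   [pairs V], the two-element sets of vertices. *)
Definition pairs (V : finType) : {set {set V}} :=
  [set e : {set V} | #|e| == 2%N]%SET.

Definition dominating (V : finType) (E : {set {set V}}) (D : {set V}) : bool :=
  [forall v, (v \notin D) ==> [exists u in D, [set u; v]%SET \in E]].

Definition gamma (V : finType) (E : {set {set V}}) : nat :=
  #|[arg min_(D < [set: V]%SET | dominating E D) #|D|]%N|.

(* B = E is admissible as soon as E is a nonempty set of pairs.  For the
   edgeless graph no B is admissible and the value is 0 by convention. *)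
Definition bondage (V : finType) (E : {set {set V}}) : nat :=
  #|[arg min_(B < E | (B \subset E) && (gamma E < gamma (E :\: B))%N) #|B|]%N|.

Definition degree (V : finType) (E : {set {set V}}) (v : V) : nat :=
  #|[set e in E | v \in e]%SET|.

Definition max_degree (V : finType) (E : {set {set V}}) : nat :=
  (\max_(v : V) degree E v)%N.

(* Probability of the event A in G(n,p): every pair is an edge independently
   with probability p, so the graph E has weight
   p ^ #|E| * (1 - p) ^ ('C(n, 2) - #|E|), written here as a product. *)
Definition gnp_prob (R : realType) (n : nat) (p : R)
    (A : pred {set {set 'I_n}}) : R :=
  \sum_(E in powerset (pairs 'I_n) | A E)
    \prod_(e in pairs 'I_n) (if e \in E then p else 1 - p).

Definition aas (R : realType) (p : nat -> R) (J : set nat)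
    (A : forall n : nat, pred {set {set 'I_n}}) : Prop :=
  gnp_prob (p n) (A n) @[n --> within J \oo] --> (1 : R).

(* A.a.s. X = Theta(Y); the hidden constants do not depend on n. *)
Definition aas_Theta (R : realType) (p : nat -> R) (J : set nat)
    (X Y : forall n : nat, {set {set 'I_n}} -> R) : Prop :=
  exists c C : R, [/\ 0 < c, 0 < C &
    aas p J (fun n E => c * Y n E <= X n E <= C * Y n E)].

Definition f (R : realType) (n k : nat) (p : R) : R :=
  'C(n, k)%:R * (1 - (1 - p) ^+ k) ^+ (n - k).

(* The minimum exists whenever p * n > 1, since f n n p = 1; the value 0 in
   the other case is arbitrary. *)
Definition r (R : realType) (n : nat) (p : R) : nat :=
  match pselect (exists k : nat, (p * n%:R)^-1 < f n k p) with
  | left h => ex_minn h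
  | right _ => 0%N
  end.

(* Main.v *)
(** Write [q = 1 - p], and let [mu = f n r p] be the expected number of dominating
    sets of size [r].  The first moment bound [f n (r - 1) p <= 1 / (p n)]
    gives [gamma >= r].  It also shows that after deleting the edges at a fixed
    vertex [v] no set of size [r] dominates: such a set contains [v], and the
    other [r - 1] vertices would dominate the rest.  Hence [b <= Delta].

    For [gamma <= r] and [b >= c p n] it suffices that, for every set [B] of at most
    [c p n] edges, some dominating [r]-set is still dominating without [B].  If
    [D] is destroyed by [B], there is [v] outside [D] all of whose neighbours in [D]
    are joined to [v] by edges of [B].  Fix a small multiple [J] of [log n].
    - If [v] has at most [J] neighbours in [D], charge [D] to an edge [uv] of [B]
      with [u] in [D].  By the Cauchy-Schwarz inequality it is enough to bound the
      sum over all pairs [uv] of the squared number of such [D]: a given [v] has few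
      neighbours in both [D] and [D'] with probability about [q^(2r)].
    - Otherwise at least [J] vertices of [D] are joined to [v] by [B].  Call [u]
      popular if it lies in more than twice the average number [mu r / n] of
      dominating [r]-sets.  The second moment shows that few dominating sets contain a
      popular vertex, and the others are counted by
      [sum_v |B_v| * (2 mu r / n) / J], which is small when [c] is.

    All second moments are sums over pairs [D, D'] with [|D :&: D'| = l].  For
    [2 l <= r] the two domination events are nearly independent, which is where
    [p^3 n >= n^(3 eps)] is used; for larger [l], the pairs contribute little because
    there are few of them, and because [mu] is superpolynomial when [D] and [D'] are
    close. *)

Require Import Defs.
From mathcomp Require Import all_boot all_order all_algebra.
From mathcomp Require Import all_classical all_reals all_analysis.
From mathcomp Require Import ring lra zify.

Set Implicit Arguments.
Unset Strict Implicit.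
Unset Printing Implicit Defensive.

Import Order.TTheory GRing.Theory Num.Theory.
Import numFieldNormedType.Exports.

Local Open Scope ring_scope.

(** * Bernoulli random subsets *)

Section BernoulliSubset.
Context {R : realType} {T : finType}.
Implicit Types (P K E : {set T}) (p : R) (F G : {set T} -> R).

Definition bern_weight P p E : R :=
  \prod_(e in P) (if e \in E then p else 1 - p).

(** Expectation of [F] over a random subset of [P] containing each element independently with
    probability [p]. As a finite weighted sum it satisfies its algebraic identities for every [p];
    probabilities are expectations of indicators cast by [%:R]. *)
Definition bexp P p F : R := \sum_(E in powerset P) F E * bern_weight P p E.

Lemma eq_bexp P p F G : (forall E, E \subset P -> F E = G E) ->
  bexp P p F = bexp P p G.
Proof. by move=> FG; apply: eq_bigr => E; rewrite powersetE => /FG ->. Qed.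

Lemma bern_weight_ge0 P p E : 0 <= p <= 1 -> 0 <= bern_weight P p E.
Proof.
by move=> /andP[p0 p1]; apply: prodr_ge0 => e _; case: ifP => // _; rewrite subr_ge0.
Qed.

Lemma ler_bexp P p F G : 0 <= p <= 1 ->
  (forall E, E \subset P -> F E <= G E) -> bexp P p F <= bexp P p G.
Proof.
move=> p01 FG; apply: ler_sum => E; rewrite powersetE => /FG FGE.
by rewrite ler_wpM2r ?bern_weight_ge0.
Qed.

Lemma bexp_ge0 P p F : 0 <= p <= 1 ->
  (forall E, E \subset P -> 0 <= F E) -> 0 <= bexp P p F.
Proof.
move=> p01 F0; apply: sumr_ge0 => E; rewrite powersetE => /F0 FE.
by rewrite mulr_ge0 ?bern_weight_ge0.
Qed.

Lemma bexpD P p F G : bexp P p (fun E => F E + G E) = bexp P p F + bexp P p G.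
Proof. by rewrite /bexp -big_split; apply: eq_bigr => E _; rewrite mulrDl. Qed.

Lemma bexpZ P p F c : bexp P p (fun E => c * F E) = c * bexp P p F.
Proof. by rewrite /bexp mulr_sumr; apply: eq_bigr => E _; rewrite mulrA. Qed.

Lemma bexpZr P p F c : bexp P p (fun E => F E * c) = bexp P p F * c.
Proof. by rewrite /bexp mulr_suml; apply: eq_bigr => E _; rewrite mulrAC. Qed.

Lemma bexpN P p F : bexp P p (fun E => - F E) = - bexp P p F.
Proof. by rewrite /bexp -sumrN; apply: eq_bigr => E _; rewrite mulNr. Qed.

Lemma bexpB P p F G : bexp P p (fun E => F E - G E) = bexp P p F - bexp P p G.
Proof. by rewrite (bexpD P p F (fun E => - G E)) bexpN. Qed.

Lemma bexp_sum (I : finType) (Q : pred I) P p (F : I -> {set T} -> R) :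
  bexp P p (fun E => \sum_(i | Q i) F i E) = \sum_(i | Q i) bexp P p (F i).
Proof. by rewrite /bexp exchange_big; apply: eq_bigr => E _; rewrite mulr_suml. Qed.

Lemma bexp_prod P p (g h : T -> R) :
  bexp P p (fun E => \prod_(e in P) (if e \in E then g e else h e)) =
  \prod_(e in P) (p * g e + (1 - p) * h e).
Proof.
(* Outside [P] the two alternatives get the values 0 and 1, so after distributing the product over
   all of [T] only subsets of [P] survive. *)
transitivity (\prod_e ((if e \in P then p * g e else 0) +
   (if e \in P then (1 - p) * h e else 1))); last first.
  rewrite [RHS]big_mkcond; apply: eq_bigr => e _; case: ifP => // _.
  by rewrite add0r.
rewrite bigA_distr /bexp [LHS]big_mkcond; apply: eq_big => // E _.
rewrite powersetE; case: ifPn => [EP|/subsetPn [e eE eP]]; last first.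
  by rewrite (bigD1 e) //= eE (negbTE eP) mul0r.
rewrite -big_split [LHS]big_mkcond; apply: eq_bigr => e _.
case: (boolP (e \in P)) => [eP|eP]; first by case: ifP => _; rewrite mulrC.
by rewrite (contraNF (fintype.subsetP EP e)).
Qed.

Lemma bexp1 P p : bexp P p (fun=> 1) = 1.
Proof.
rewrite (@eq_bexp _ _ _ (fun E => \prod_(e in P) (if e \in E then 1 else 1))).
  by rewrite bexp_prod big1 // => e _; rewrite !mulr1 addrC subrK.
by move=> E _; rewrite big1 // => e _; case: ifP.
Qed.

Lemma bexp_cst P p c : bexp P p (fun=> c) = c.
Proof.
by rewrite -[RHS]mulr1 -(bexp1 P p) -bexpZ; apply: eq_bexp => E _; rewrite mulr1.
Qed.

(** Fubini: the parts of the random set inside and outside [K] are independent. *)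
Lemma bexp_split K P p F :
  bexp P p F =
  bexp (P :&: K) p (fun E1 => bexp (P :\: K) p (fun E2 => F (E1 :|: E2))).
Proof.
rewrite /bexp.
transitivity (\sum_(E1 in powerset (P :&: K)) \sum_(E2 in powerset (P :\: K))
   F (E1 :|: E2) * (bern_weight (P :\: K) p E2 * bern_weight (P :&: K) p E1));
  last first.
  apply: eq_bigr => E1 _; rewrite big_distrl; apply: eq_bigr => E2 _.
  by rewrite mulrA.
rewrite pair_big_dep /=.
rewrite (reindex_onto (fun x : {set T} * {set T} => x.1 :|: x.2)
          (fun E => (E :&: K, E :\: K))) /=; last by move=> E _; rewrite setID.
have dis E1 E2 : E1 \subset P :&: K -> E2 \subset P :\: K ->
   ((E1 :|: E2) :&: K = E1) /\ ((E1 :|: E2) :\: K = E2).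
  move=> s1 s2; split; apply/setP => x; rewrite !inE.
    have /implyP := fintype.subsetP s1 x; have /implyP := fintype.subsetP s2 x; rewrite !inE.
    by case: (x \in E1); case: (x \in E2); case: (x \in K); case: (x \in P).
  have /implyP := fintype.subsetP s1 x; have /implyP := fintype.subsetP s2 x; rewrite !inE.
  by case: (x \in E1); case: (x \in E2); case: (x \in K); case: (x \in P).
apply: eq_big => [[E1 E2]|[E1 E2]] /=; rewrite !powersetE.
  apply/andP/andP => [[sP /eqP [e1 e2]]|[s1 s2]].
    by split; [rewrite -e1 finset.setSI | rewrite -e2 finset.setSD].
  split; last by have [-> ->] := dis _ _ s1 s2.
  rewrite finset.subUset (fintype.subset_trans s1) ?finset.subsetIl //.
  by rewrite (fintype.subset_trans s2) ?finset.subsetDl.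
move=> /andP[sP /eqP [e1 e2]]; congr (_ * _); rewrite mulrC.
rewrite /bern_weight (big_setID K) /=; congr (_ * _); apply: eq_bigr => e.
  by rewrite inE => /andP[_ eK]; rewrite -{2}e1 !inE eK andbT.
by rewrite inE => /andP[eK _]; rewrite -{2}e2 !inE eK.
Qed.

Lemma bexp_indep K P p F G :
  (forall E, F (E :&: K) = F E) -> (forall E, G (E :\: K) = G E) ->
  bexp P p (fun E => F E * G E) = bexp P p F * bexp P p G.
Proof.
move=> FK GK.
have e1 E1 E2 : E1 \subset P :&: K -> E2 \subset P :\: K -> F (E1 :|: E2) = F E1.
  move=> s1 s2; rewrite -FK -[RHS]FK; congr F; apply/setP => x; rewrite !inE.
  have /implyP := fintype.subsetP s2 x; rewrite !inE.
  by case: (x \in E1); case: (x \in E2); case: (x \in K); case: (x \in P).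
have e2 E1 E2 : E1 \subset P :&: K -> E2 \subset P :\: K -> G (E1 :|: E2) = G E2.
  move=> s1 s2; rewrite -GK -[RHS]GK; congr G; apply/setP => x; rewrite !inE.
  have /implyP := fintype.subsetP s1 x; rewrite !inE.
  by case: (x \in E1); case: (x \in E2); case: (x \in K); case: (x \in P).
rewrite (bexp_split K P p F) (bexp_split K P p G) (bexp_split K P p (fun _ => _ * _)).
transitivity (bexp (P :&: K) p (fun E1 => F E1 * bexp (P :\: K) p G)).
  apply: eq_bexp => E1 s1; rewrite -bexpZ; apply: eq_bexp => E2 s2.
  by rewrite e1 ?e2.
rewrite bexpZr; congr (_ * _).
  apply: eq_bexp => E1 s1; rewrite -[LHS](bexp_cst (P :\: K) p).
  by apply: eq_bexp => E2 s2; rewrite (e1 E1 E2).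
rewrite -[LHS](bexp_cst (P :&: K) p); apply: eq_bexp => E1 s1.
by apply: eq_bexp => E2 s2; rewrite (e2 E1 E2).
Qed.

(** Induction on the number of factors: by disjointness the other factors ignore [K i], so
    [bexp_indep] splits off [h i]. *)
Lemma bexp_indep_prod (I : finType) (A : {set I}) (K : I -> {set T})
    (h : I -> {set T} -> R) P p :
  (forall i j, i \in A -> j \in A -> i != j -> [disjoint K i & K j]) ->
  (forall i E, i \in A -> h i (E :&: K i) = h i E) ->
  bexp P p (fun E => \prod_(i in A) h i E) = \prod_(i in A) bexp P p (h i).
Proof.
elim: {A}#|A| {-2}A (erefl #|A|) => [|m IH] A cA disK hK.
  move/eqP: cA; rewrite cards_eq0 => /eqP ->.
  by rewrite [RHS]big_set0 -[RHS](bexp1 P p); apply: eq_bexp => E _; rewrite big_set0.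
have [i iA] : exists i, i \in A by apply/set0Pn; rewrite -card_gt0 cA.
rewrite [RHS](big_setD1 i) //= -(IH (A :\ i)).
- rewrite -(@bexp_indep (K i)).
  + by apply: eq_bexp => E _; rewrite (big_setD1 i).
  + by move=> E; exact: hK.
  + move=> E; apply: eq_bigr => j; rewrite !inE => /andP[ji jA].
    rewrite -(hK j _ jA) -[RHS](hK j _ jA); congr h; apply/setP => x; rewrite !inE.
    have [xj|] := boolP (x \in K j); last by rewrite !andbF.
    by rewrite (disjointFr (disK _ _ jA iA ji) xj).
- by have := cardsD1 i A; rewrite iA cA => -[].
- by move=> j k; rewrite !inE => /andP[_ jA] /andP[_ kA]; exact: disK.
- by move=> j E; rewrite !inE => /andP[_ jA]; exact: hK.
Qed.

Lemma bexp_disjoint_from P p (D : {set T}) : D \subset P ->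
  bexp P p (fun E => [disjoint E & D]%:R) = (1 - p) ^+ #|D|.
Proof.
move=> DP.
rewrite (@eq_bexp _ _ _ (fun E => \prod_(e in P)
   (if e \in E then (e \notin D)%:R else 1))); last first.
  move=> E EP; case: (boolP [disjoint E & D]) => [dED|].
    rewrite big1 // => e _; case: ifP => // eE.
    by rewrite (disjointFr dED eE).
  rewrite -setI_eq0 => /set0Pn [e]; rewrite inE => /andP[eE eD].
  by rewrite (bigD1 e) ?(fintype.subsetP EP) //= eE eD mul0r.
rewrite bexp_prod (big_setID D) /= (finset.setIidPr DP).
rewrite [X in _ * X]big1 => [|e]; last first.
  by rewrite inE => /andP[-> _]; rewrite !mulr1 addrC subrK.
rewrite mulr1 -prodr_const; apply: eq_bigr => e eD.
by rewrite eD mulr0 add0r mulr1.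
Qed.

Lemma bexp_expn_card P p s : bexp P p (fun E => s ^+ #|E|) = (p * s + (1 - p)) ^+ #|P|.
Proof.
rewrite (@eq_bexp _ _ _ (fun E => \prod_(e in P) (if e \in E then s else 1))).
  by rewrite bexp_prod -prodr_const; apply: eq_bigr => e _; rewrite mulr1.
move=> E EP; rewrite -prodr_const [RHS](big_setID E) /= (finset.setIidPr EP).
rewrite [X in _ = _ * X]big1 ?mulr1; last first.
  by move=> e; rewrite inE => /andP[/negbTE ->].
by apply: eq_bigr => e ->.
Qed.

Lemma bexp_expn_card_in P p s u : u \in P ->
  bexp P p (fun E => (u \in E)%:R * s ^+ #|E :\ u|) =
  p * (p * s + (1 - p)) ^+ #|P|.-1.
Proof.
move=> uP.
rewrite (@eq_bexp _ _ _ (fun E => \prod_(e in P)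
   (if e \in E then (if e == u then 1 else s) else (e != u)%:R))).
  rewrite bexp_prod (big_setD1 u) //= eqxx !mulr1 mulr0 addr0; congr (_ * _).
  have -> : #|P|.-1 = #|P :\ u| by rewrite (cardsD1 u) uP.
  rewrite -prodr_const; apply: eq_bigr => e; rewrite !inE => /andP[/negbTE ->].
  by rewrite mulr1.
move=> E EP; rewrite (big_setD1 u) //= eqxx /=.
case: (boolP (u \in E)) => uE; last by rewrite !mul0r.
rewrite !mul1r -prodr_const [RHS](big_setID E) /=.
have -> : (P :\ u) :&: E = E :\ u.
  by rewrite finset.setIDAC (finset.setIidPr EP).
rewrite [X in _ = _ * X]big1 ?mulr1; last first.
  by move=> e; rewrite !inE => /andP[/negbTE -> /andP[->]].
by apply: eq_bigr => e; rewrite !inE => /andP[/negbTE -> ->].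
Qed.

Lemma bexp_markov P p F c (A : pred {set T}) : 0 <= p <= 1 -> 0 < c ->
  (forall E, E \subset P -> 0 <= F E) ->
  (forall E, E \subset P -> A E -> c <= F E) ->
  bexp P p (fun E => (A E)%:R) <= bexp P p F / c.
Proof.
move=> p01 c0 F0 AF; rewrite ler_pdivlMr // mulrC -bexpZ.
apply: ler_bexp => // E EP; case: (boolP (A E)) => AE; last by rewrite mulr0 F0.
by rewrite mulr1 AF.
Qed.

End BernoulliSubset.

Lemma bexp_imset (R : realType) (S T : finType) (f : S -> T) (U : {set S}) (p : R)
    (F : {set T} -> R) : injective f ->
  bexp (f @: U) p F = bexp U p (fun E => F (f @: E)).
Proof.
move=> finj; rewrite /bexp.
have -> : powerset (f @: U) = (fun E : {set S} => f @: E) @: powerset U.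
  apply/setP => E; rewrite powersetE; apply/idP/imsetP => [EU|[E' +] ->].
    exists (f @^-1: E).
      rewrite powersetE; apply/fintype.subsetP => x; rewrite inE => /(fintype.subsetP EU).
      by rewrite mem_imset.
    apply/setP => x; apply/idP/imsetP => [xE|[y + ->]]; last by rewrite inE.
    by have /imsetP [y _ xy] := fintype.subsetP EU x xE; exists y; rewrite ?inE -?xy.
  by rewrite powersetE => EU; exact: imsetS.
rewrite big_imset /=; last by move=> E1 E2 _ _; exact: imset_inj.
apply: eq_bigr => E _; congr (_ * _).
rewrite /bern_weight big_imset /=; last by move=> x y _ _; exact: finj.
by apply: eq_bigr => e _; rewrite mem_imset.
Qed.

(** * Neighbourhoods and domination in the random graph *)

Section RandomGraph.
Context {R : realType} {V : finType}.
Implicit Types (E : {set {set V}}) (D A U : {set V}) (p : R) (v w : V).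

Definition nb E w : {set V} := [set u | [set u; w]%SET \in E].

Lemma dominatingE E D :
  dominating E D = [forall v in ~: D, ~~ [disjoint nb E v & D]].
Proof.
apply: eq_forallb => v; rewrite inE; congr (_ ==> _).
rewrite -setI_eq0; apply/'exists_andP/set0Pn => -[u].
  by move=> [uD uE]; exists u; rewrite !inE uE.
by rewrite !inE => /andP[uE uD]; exists u.
Qed.

Definition star U w : {set {set V}} := (fun u => [set u; w]%SET) @: U.

Lemma set2_inj w : injective (fun u => [set u; w]%SET).
Proof.
move=> u u' /= e; have := set21 u w; rewrite e !inE => /orP[/eqP //|/eqP uw].
by have := set21 u' w; rewrite -e uw !inE orbb => /eqP.
Qed.

Lemma star_sub_pairs U w : w \notin U -> star U w \subset pairs V.
Proof.
move=> wU; apply/fintype.subsetP => e /imsetP [u uU ->]; rewrite inE cards2.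
by have -> : u != w by apply: contraNneq wU => <-.
Qed.

Lemma star_disjoint U w w' : w \notin U -> w' \notin U -> w != w' ->
  [disjoint star U w & star U w'].
Proof.
move=> wU w'U ww'; rewrite -setI_eq0; apply/eqP/setP => e; rewrite !inE.
apply/negP => /andP[/imsetP [u uU ->] /imsetP [u' u'U eq]].
have := set22 u w; rewrite eq !inE (negbTE ww') orbF => /eqP wu'.
by rewrite wu' u'U in wU.
Qed.

Lemma nb_setI_star E U w : nb (E :&: star U w) w :&: U = nb E w :&: U.
Proof.
apply/setP => u; rewrite !inE; case: (boolP (u \in U)) => uU; last by rewrite !andbF.
by rewrite !andbT (mem_imset _ _ (@set2_inj w)) uU andbT.
Qed.

(** As [w] is outside [U], the pairs joining it to [U] are genuine pairs, one for each vertex of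
    [U]. Hence the neighbourhood of [w] in [U] is a Bernoulli subset of [U]. *)
Lemma bexp_star U w p (h : {set V} -> R) : w \notin U ->
  bexp (pairs V) p (fun E => h (nb E w :&: U)) = bexp U p h.
Proof.
move=> wU; rewrite (bexp_split (star U w)).
rewrite (finset.setIidPr (star_sub_pairs wU)).
transitivity (bexp (star U w) p (fun E => h (nb E w :&: U))).
  apply: eq_bexp => E1 s1.
  rewrite -[RHS](bexp_cst (pairs V :\: star U w) p); apply: eq_bexp => E2 s2.
  congr h; rewrite -nb_setI_star -[RHS]nb_setI_star; congr (nb _ _ :&: _).
  apply/setP => x; rewrite !inE; have /implyP := fintype.subsetP s2 x; rewrite !inE.
  by case: (x \in E1); case: (x \in E2); case: (x \in star U w).
rewrite (bexp_imset _ _ _ (@set2_inj w)); apply: eq_bexp => S SU; congr h.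
apply/setP => u; rewrite !inE (mem_imset _ _ (@set2_inj w)).
by case: (boolP (u \in S)) => //= uS; rewrite (fintype.subsetP SU).
Qed.

(** Distinct vertices outside [U] have disjoint stars, so their neighbourhoods in [U] are
    independent. The domination probabilities below are all instances. *)
Lemma bexp_stars U A p (h : V -> {set V} -> R) : [disjoint A & U] ->
  bexp (pairs V) p (fun E => \prod_(w in A) h w (nb E w :&: U)) =
  \prod_(w in A) bexp U p (h w).
Proof.
move=> dAU; have nU w : w \in A -> w \notin U by move=> wA; rewrite (disjointFr dAU).
rewrite (bexp_indep_prod (K := star U)).
- by apply: eq_bigr => w wA; rewrite bexp_star ?nU.
- by move=> i j /nU iA /nU jA ij; exact: star_disjoint.
- by move=> i E _; rewrite nb_setI_star.
Qed.

Definition hit2 D D' (S : {set V}) : R :=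
  (~~ [disjoint S & D])%:R * (~~ [disjoint S & D'])%:R.

(** Inclusion-exclusion over the events that [S] misses [D] and that it misses [D']. *)
Lemma bexp_hit2 D D' U p : D \subset U -> D' \subset U ->
  bexp U p (hit2 D D') =
  1 - (1 - p) ^+ #|D| - (1 - p) ^+ #|D'| + (1 - p) ^+ #|D :|: D'|.
Proof.
move=> DU D'U.
rewrite -(bexp_disjoint_from p DU) -(bexp_disjoint_from p D'U).
rewrite -(@bexp_disjoint_from _ _ U p (D :|: D')) ?finset.subUset ?DU //.
rewrite -{1}(bexp1 U p) -!bexpB -bexpD; apply: eq_bexp => S _; rewrite /hit2.
have -> : [disjoint S & D :|: D'] = [disjoint S & D] && [disjoint S & D'].
  by rewrite -!setI_eq0 finset.setIUr finset.setU_eq0.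
case: [disjoint S & D]; case: [disjoint S & D'] => /=; lra.
Qed.

(** Restricting the dominated vertices to a set [A] disjoint from the dominating sets under study
    keeps the relevant stars independent. *)
Definition dominates_on E A D := [forall w in A, ~~ [disjoint nb E w & D]].

Lemma disjoint_setIr (S D U : {set V}) : D \subset U -> [disjoint S :&: U & D] = [disjoint S & D].
Proof. by move=> DU; rewrite -!setI_eq0 -finset.setIA (finset.setIidPr DU). Qed.

Lemma forall_in_prodR (A : {set V}) (P : pred V) :
  ([forall w in A, P w])%:R = \prod_(w in A) (P w)%:R :> R.
Proof.
case: (boolP [forall w in A, P w]) => [/forall_inP h|].
  by rewrite big1 // => w /h ->.
by rewrite negb_forall_in => /exists_inP [w wA /negbTE wP]; rewrite (bigD1 w) //= wP mul0r.
Qed.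

Lemma prob_dominates_on D A p : [disjoint A & D] ->
  bexp (pairs V) p (fun E => (dominates_on E A D)%:R) = (1 - (1 - p) ^+ #|D|) ^+ #|A|.
Proof.
move=> dAD.
rewrite -prodr_const -(@eq_bexp _ _ _ _ (fun E => \prod_(w in A) hit2 D D (nb E w :&: D))).
  rewrite (bexp_stars p (fun=> hit2 D D) dAD); apply: eq_bigr => w _.
  by rewrite bexp_hit2 // finset.setUid; ring.
move=> E _; rewrite /dominates_on forall_in_prodR; apply: eq_bigr => w _.
by rewrite /hit2 disjoint_setIr // -natrM mulnb andbb.
Qed.

Lemma prob_dominates2_on D D' A p : [disjoint A & D :|: D'] ->
  bexp (pairs V) p (fun E => (dominates_on E A D)%:R * (dominates_on E A D')%:R) =
  (1 - (1 - p) ^+ #|D| - (1 - p) ^+ #|D'| + (1 - p) ^+ #|D :|: D'|) ^+ #|A|.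
Proof.
move=> dAD.
rewrite -prodr_const -(@eq_bexp _ _ _ _ (fun E => \prod_(w in A) hit2 D D' (nb E w :&: (D :|: D')))).
  rewrite (bexp_stars p (fun=> hit2 D D') dAD); apply: eq_bigr => w _.
  by rewrite bexp_hit2 ?finset.subsetUl ?finset.subsetUr.
move=> E _; rewrite /dominates_on !forall_in_prodR -big_split /=; apply: eq_bigr => w _.
by rewrite /hit2 !disjoint_setIr ?finset.subsetUl ?finset.subsetUr.
Qed.

(* [v] is an extra vertex whose own star is used only for the weight, so it is
   independent of the domination of [A]. *)
Lemma prob_dominates2_on_weighted D D' A p s u v : [disjoint A & D :|: D'] ->
  v \notin A -> v \notin D :|: D' -> u \in D :|: D' ->
  bexp (pairs V) p (fun E => (dominates_on E A D)%:R * (dominates_on E A D')%:R *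
     ((u \in nb E v)%:R * s ^+ #|(nb E v :&: (D :|: D')) :\ u|)) =
  (1 - (1 - p) ^+ #|D| - (1 - p) ^+ #|D'| + (1 - p) ^+ #|D :|: D'|) ^+ #|A| *
  (p * (p * s + (1 - p)) ^+ #|D :|: D'|.-1).
Proof.
move=> dAD vA vD uD.
set wt := fun S : {set V} => (u \in S)%:R * s ^+ #|S :\ u| : R.
rewrite -prodr_const -(@eq_bexp _ _ _ _ (fun E => \prod_(w in v |: A)
   (if w == v then wt else hit2 D D') (nb E w :&: (D :|: D')))).
  rewrite (bexp_stars p (fun w => if w == v then wt else hit2 D D')); last first.
    rewrite -setI_eq0 finset.setIUl; move: dAD; rewrite -setI_eq0 => /eqP ->.
    rewrite finset.setU0 setI_eq0 disjoints1 //.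
  rewrite (big_setU1 _ vA) /= eqxx bexp_expn_card_in // mulrC; congr (_ * _).
  apply: eq_bigr => w wA; case: eqVneq => [wv|_]; first by rewrite -wv wA in vA.
  by rewrite bexp_hit2 ?finset.subsetUl ?finset.subsetUr.
move=> E _; rewrite (big_setU1 _ vA) /= eqxx /dominates_on !forall_in_prodR -big_split /=.
rewrite mulrC; congr (_ * _); last by rewrite /wt inE uD andbT.
apply: eq_bigr => w wA; case: eqVneq => [wv|_]; first by rewrite -wv wA in vA.
by rewrite /hit2 !disjoint_setIr ?finset.subsetUl ?finset.subsetUr.
Qed.

Lemma degree_nb E v : E \subset pairs V -> degree E v = #|nb E v|.
Proof.
move=> EP; rewrite /degree -(card_imset _ (@set2_inj v)); apply: eq_card => e.
rewrite inE; apply/idP/imsetP => [/andP[eE ve]|[u + ->]]; last first.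
  by rewrite inE set22 andbT.
have := fintype.subsetP EP e eE; rewrite inE => /cards2P [x [y [xy exy]]].
move: ve eE; rewrite exy !inE => /orP[] /eqP -> eE.
  by exists y; rewrite ?inE finset.setUC.
by exists x; rewrite ?inE.
Qed.

Lemma nb_irrefl E v : E \subset pairs V -> v \notin nb E v.
Proof.
move=> EP; rewrite inE finset.setUid; apply/negP => /(fintype.subsetP EP).
by rewrite inE cards1.
Qed.

Lemma bexp_expn_degree p s v :
  bexp (pairs V) p (fun E => s ^+ degree E v) = (p * s + (1 - p)) ^+ #|V|.-1.
Proof.
have cV : #|V|.-1 = #|[set~ v]| by rewrite cardsC1.
rewrite cV -bexp_expn_card -(@bexp_star _ v) ?inE ?eqxx //.
apply: eq_bexp => E EP; rewrite degree_nb //; congr (_ ^+ _); apply: eq_card => u.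
by rewrite !inE; case: eqVneq => [->|_]; rewrite ?andbT // andbF; have := nb_irrefl v EP; rewrite inE => /negbTE.
Qed.

End RandomGraph.

(** * Domination and bondage in a fixed graph *)

Section Deterministic.
Context {V : finType}.
Implicit Types (E B : {set {set V}}) (D : {set V}).

Definition dsets k : {set {set V}} := [set D : {set V} | #|D| == k].

Lemma card_supersets (T : {set V}) k : (#|T| <= k <= #|V|)%N ->
  #|[set D in dsets k | T \subset D]| = 'C(#|V| - #|T|, k - #|T|).
Proof.
move=> /andP[Tk kV].
rewrite -(card_imset _ (can_inj (@finset.setCK V))).
have -> : (@finset.setC V) @: [set D in dsets k | T \subset D] =
    [set D : {set V} | D \subset ~: T & #|D| == (#|V| - k)%N].
  apply/setP => D; apply/imsetP/idP => [[D' + ->]|].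
    rewrite !inE => /andP[/eqP cD' TD']; rewrite finset.setCS TD'.
    by rewrite [X in _ && (X == _)]cardsCs finset.setCK cD' eqxx.
  rewrite inE => /andP[DT /eqP cD]; exists (~: D); last by rewrite finset.setCK.
  rewrite !inE -finset.setCS finset.setCK DT andbT cardsCs finset.setCK cD subKn //.
rewrite cards_draws [X in 'C(X, _)]cardsCs finset.setCK.
rewrite -bin_sub; last by lia.
by congr 'C(_, _); lia.
Qed.

(** Double counting of triples [D], [T], [D'] with [T] an [l]-subset of both sets: choose [D], then
    [T] inside it, then [D'] above [T]. *)
Lemma sum_bin_meet k l : (l <= k <= #|V|)%N ->
  (\sum_(D in dsets k) \sum_(D' in dsets k) 'C(#|D :&: D'|, l) =
   'C(#|V|, k) * ('C(k, l) * 'C(#|V| - l, k - l)))%N.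
Proof.
move=> /andP[lk kV].
rewrite -(card_draws V k) -sum_nat_const.
apply: eq_bigr => D; rewrite inE => /eqP cD.
have e D' : 'C(#|D :&: D'|, l) =
   (\sum_(T in [set T : {set V} | T \subset D & #|T| == l]) (T \subset D'))%N.
  rewrite -cards_draws -sum1_card big_mkcond [RHS]big_mkcond; apply: eq_bigr => T _.
  by rewrite !inE finset.subsetI; case: (T \subset D); case: (T \subset D'); case: (_ == l).
under eq_bigr => D' _ do rewrite e.
rewrite exchange_big /=.
rewrite -cD -(cards_draws D l) -sum_nat_const.
apply: eq_bigr => T; rewrite inE => /andP[TD /eqP cT].
rewrite -cT -card_supersets ?cT; last by rewrite cD lk kV.
rewrite -[RHS]sum1_card [RHS]big_mkcond [LHS]big_mkcond /=; apply: eq_bigr => D' _.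
by rewrite !inE cD; case: ifP; case: (T \subset D').
Qed.

Lemma dominating_dominates_on E D : dominating E D = dominates_on E (~: D) D.
Proof. exact: dominatingE. Qed.

Lemma dominating_superset E D D' : D \subset D' -> dominating E D -> dominating E D'.
Proof.
move=> DD' /forallP dom; apply/forallP => v; apply/implyP => vD'.
have vD : v \notin D by apply: contra vD'; exact: (fintype.subsetP DD').
have /implyP/(_ vD)/exists_inP [u uD uE] := dom v.
by apply/exists_inP; exists u => //; exact: (fintype.subsetP DD').
Qed.

Lemma gamma_witness E : {D : {set V} | dominating E D & #|D| = gamma E}.
Proof.
rewrite /gamma; case: arg_minnP => [|D domD _]; last by exists D.
by apply/forallP => v; rewrite !inE.
Qed.

Lemma gamma_le E D : dominating E D -> (gamma E <= #|D|)%N.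
Proof.
move=> domD; rewrite /gamma; case: arg_minnP => [|D' _]; last exact.
by apply/forallP => v; rewrite !inE.
Qed.

Lemma superset_of_card D k : (#|D| <= k <= #|V|)%N ->
  exists2 D' : {set V}, D \subset D' & #|D'| = k.
Proof.
move=> Dk; have := card_supersets Dk.
have : (0 < 'C(#|V| - #|D|, k - #|D|))%N by rewrite bin_gt0; lia.
move=> /[swap] <-; rewrite card_gt0 => /set0Pn [D'].
by rewrite !inE => /andP[/eqP cD' DD']; exists D'.
Qed.

Lemma dominating_of_card E k : (gamma E <= k <= #|V|)%N ->
  exists2 D, D \in dsets k & dominating E D.
Proof.
case: (gamma_witness E) => D domD <- /superset_of_card [D' DD' cD'].
by exists D'; [rewrite inE cD' | exact: dominating_superset domD].
Qed.

Definition incident E v := [set e in E | v \in e]%SET.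

(** Once isolated, [v] lies in every dominating set and helps no other vertex. A dominating [k]-set
    would leave [k - 1] vertices dominating everything else, already in [E]. *)
Lemma isolating_increases_gamma E v k : E \subset pairs V -> (0 < k <= #|V|)%N ->
  (forall D, D \in dsets k.-1 -> v \notin D -> ~~ dominates_on E (~: (v |: D)) D) ->
  (k < gamma (E :\: incident E v))%N.
Proof.
move=> EP /andP[k0 kV] nodom; rewrite ltnNge; apply/negP => gk.
have /dominating_of_card [D] : (gamma (E :\: incident E v) <= k <= #|V|)%N by rewrite gk.
rewrite inE => /eqP cD /forallP dom.
have vD : v \in D.
  apply/contraT => vD; have /implyP/(_ vD)/exists_inP [u uD] := dom v.
  by rewrite !inE eqxx orbT andbT => /andP[/negbTE ->].
have Dk : D :\ v \in dsets k.-1 by rewrite inE -cD (cardsD1 v D) vD.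
have Dv : v \notin D :\ v by rewrite !inE eqxx.
apply: (negP (nodom _ Dk Dv)); apply/forall_inP => w; rewrite finset.setD1K // inE => wD.
have /implyP/(_ wD)/exists_inP [u uD] := dom w.
rewrite inE => /andP[uwB uwE]; rewrite -setI_eq0; apply/set0Pn; exists u.
rewrite !inE uwE uD andbT; apply/negP => /eqP uv.
by move: uwB; rewrite !inE uwE uv eqxx.
Qed.

(** The default [E] of the [arg min] is not known to be admissible, so the definition is unfolded;
    [arg_minnP] with default [B] shows that a minimiser exists. *)
Lemma bondage_le E B : B \subset E -> (gamma E < gamma (E :\: B))%N -> (bondage E <= #|B|)%N.
Proof.
move=> BE gB; rewrite /bondage /arg_min /extremum; case: pickP => [B' /andP[_ /forall_inP]|].
  by move/(_ B); rewrite BE gB; exact.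
move=> none; exfalso; have aB : (B \subset E) && (gamma E < gamma (E :\: B))%N by rewrite BE.
case: (@arg_minnP _ B (fun B => (B \subset E) && (gamma E < gamma (E :\: B))%N) (fun B => #|B|) aB).
move=> B' aB' minB'; have := none B'; rewrite /= aB' /= => /negP; apply.
by apply/forall_inP => B'' /minB'.
Qed.

Lemma bondage_witness E B0 : B0 \subset E -> (gamma E < gamma (E :\: B0))%N ->
  exists B, [/\ B \subset E, (gamma E < gamma (E :\: B))%N & #|B| = bondage E].
Proof.
move=> BE gB; rewrite /bondage /arg_min /extremum; case: pickP => [B' /andP[/andP[BE' gB'] _]|].
  by exists B'.
move=> none; exfalso; have aB : (B0 \subset E) && (gamma E < gamma (E :\: B0))%N by rewrite BE.
case: (@arg_minnP _ B0 (fun B => (B \subset E) && (gamma E < gamma (E :\: B))%N) (fun B => #|B|) aB).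
move=> B' aB' minB'; have := none B'; rewrite /= aB' /= => /negP; apply.
by apply/forall_inP => B'' /minB'.
Qed.

Lemma card_directed B : B \subset pairs V ->
  (#|[set x : V * V | [set x.2; x.1]%SET \in B]| <= 2 * #|B|)%N.
Proof.
move=> BP; rewrite mulnC -sum_nat_const.
rewrite -sum1_card (partition_big (fun x : V * V => [set x.2; x.1]%SET) (mem B)) /=; last first.
  by move=> x; rewrite inE.
apply: leq_sum => e eB; have := fintype.subsetP BP e eB.
rewrite inE => /cards2P [x [y [xy exy]]].
apply: (@leq_trans #|[set (x, y); (y, x)]%SET|); last by rewrite cards2; case: (_ != _).
rewrite sum1_card; apply: subset_leq_card; apply/fintype.subsetP => -[v u].
rewrite !inE => /andP[_ /eqP /=]; rewrite exy => euv.
have ux := set21 u v; have vx := set22 u v; have xu := set21 x y; have yu := set22 x y.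
rewrite euv in ux vx; rewrite -euv in xu yu.
move: ux vx xu yu; rewrite !inE !xpair_eqE.
by move=> /orP[] /eqP -> /orP[] /eqP ->; rewrite ?eqxx ?orbT ?orbb //= => xu yu;
  rewrite ?xu ?yu // eq_sym ?xu ?yu.
Qed.

End Deterministic.

(** * Dominating sets destroyed by deleting edges *)

Section DominatingCounts.
Context {R : realType} {V : finType}.
Variable k : nat.
Implicit Types (E B : {set {set V}}) (D : {set V}) (u v : V) (p s : R).

Definition ndom E : R := \sum_(D in dsets k) (dominating E D)%:R.

Definition ndom_at E u : R :=
  \sum_(D in dsets k) (dominating E D)%:R * (u \in D)%:R.

(* The factor [s ^+ _], with [0 < s < 1], replaces the indicator that [v] has
   few neighbours in [D]: it factorizes over the edges at [v]. *)
Definition ndom_light s E v u : R :=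
  \sum_(D in dsets k) (dominating E D)%:R * (u \in D)%:R * (v \notin D)%:R *
    ((u \in nb E v)%:R * s ^+ #|(nb E v :&: D) :\ u|).

Lemma sum_ndom_at E : \sum_u ndom_at E u = k%:R * ndom E.
Proof.
rewrite exchange_big mulr_sumr; apply: eq_bigr => D; rewrite inE => /eqP cD.
rewrite -mulr_sumr mulrC -natr_sum; congr (_%:R * _); rewrite -cD -sum1_card.
by rewrite [RHS]big_mkcond; apply: eq_bigr => u _; case: (u \in D).
Qed.

(** Where [x > 2 * z], the deviation [x - z] exceeds [x / 2], whence [x * z <= 2 * (x - z) ^+ 2]. *)
Lemma heavy_sum_le E z : 0 < z ->
  \sum_(u | 2 * z < ndom_at E u) ndom_at E u <=
  2 * (\sum_u (ndom_at E u - z) ^+ 2) / z.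
Proof.
move=> z0; rewrite ler_pdivlMr // mulr_suml mulr_sumr big_mkcond /=.
apply: ler_sum => u _; case: ifP => [h|_]; last by rewrite mulr_ge0 ?sqr_ge0.
nra.
Qed.

(** Deterministic charging inequality for a deletion that destroys all dominating [k]-sets. Popular
    means above [2 * z], [sJ] bounds from below the weight of a set with few neighbours, and [lam]
    balances the size of [B] against the sum of squares. *)
Lemma killed_bound E B s sJ J lam z : B \subset E -> E \subset pairs V ->
  0 <= s -> 0 < sJ -> 0 < J -> 0 < lam -> 0 < z ->
  (forall j : nat, j%:R <= J -> sJ <= s ^+ j) ->
  (forall D, D \in dsets k -> ~~ dominating (E :\: B) D) ->
  ndom E <= (2 * #|B|%:R * lam + (\sum_v \sum_u ndom_light s E v u ^+ 2) / lam) / sJ +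
     2 * (\sum_u (ndom_at E u - z) ^+ 2) / z + 2 * #|B|%:R * (2 * z) / J.
Proof.
move=> BE EP s0 sJ0 J0 lam0 z0 sJs killed.
pose dB := [set x : V * V | [set x.2; x.1]%SET \in B].
pose W u := 2 * z < ndom_at E u.
have cdB : #|dB|%:R <= 2 * #|B|%:R :> R.
  by rewrite -natrM ler_nat card_directed // (fintype.subset_trans BE).
(* The three sums are the charges of the three cases. All are nonnegative, so in each case it
   suffices that one of them reaches 1. *)
have pointwise D : D \in dsets k -> (dominating E D)%:R <=
    \sum_(x in dB) ((dominating E D)%:R * (x.2 \in D)%:R * (x.1 \notin D)%:R *
      ((x.2 \in nb E x.1)%:R * s ^+ #|(nb E x.1 :&: D) :\ x.2|)) / sJ +
    \sum_(u | W u) (dominating E D)%:R * (u \in D)%:R +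
    \sum_(x in dB | ~~ W x.2) (dominating E D)%:R * (x.2 \in D)%:R / J :> R.
  move=> Dk.
  have t0 (x : V * V) : 0 <= (dominating E D)%:R * (x.2 \in D)%:R * (x.1 \notin D)%:R *
      ((x.2 \in nb E x.1)%:R * s ^+ #|(nb E x.1 :&: D) :\ x.2|) / sJ :> R.
    by rewrite !mulr_ge0 ?ler0n ?invr_ge0 ?exprn_ge0 // ltW.
  have S1 : 0 <= \sum_(x in dB) ((dominating E D)%:R * (x.2 \in D)%:R * (x.1 \notin D)%:R *
      ((x.2 \in nb E x.1)%:R * s ^+ #|(nb E x.1 :&: D) :\ x.2|)) / sJ :> R.
    by apply: sumr_ge0.
  have S2 : 0 <= \sum_(u | W u) (dominating E D)%:R * (u \in D)%:R :> R.
    by apply: sumr_ge0 => u _; rewrite mulr_ge0 ?ler0n.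
  have S3 : 0 <= \sum_(x in dB | ~~ W x.2) (dominating E D)%:R * (x.2 \in D)%:R / J :> R.
    by apply: sumr_ge0 => u _; rewrite !mulr_ge0 ?ler0n ?invr_ge0 // ltW.
  case: (boolP (dominating E D)) => [domD|]; last first.
    by move=> nd; rewrite (negbTE nd) in S1 S2 S3; rewrite !addr_ge0.
  rewrite domD in t0 S1 S2 S3; rewrite [leLHS](_ : _ = 1) //.
  move: S1 S2 S3; set s1 := \sum_(x in dB) _; set s2 := \sum_(u | W u) _.
  set s3 := \sum_(x in dB | _) _ => S1 S2 S3.
  move: (killed D Dk); rewrite dominatingE negb_forall_in => /exists_inP [v].
  rewrite inE negbK => vD dBv.
  have sub u : u \in nb E v :&: D -> (v, u) \in dB.
    rewrite !inE => /andP[uE uD]; apply/contraT => uB.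
    by have := disjointFl dBv uD; rewrite !inE uB uE.
  have [u uND] : exists u, u \in nb E v :&: D.
    move: domD; rewrite dominatingE => /forall_inP /(_ v); rewrite inE => /(_ vD).
    by rewrite -setI_eq0 => /set0Pn.
  have uN : u \in nb E v by move: uND; rewrite inE => /andP[].
  have uD : u \in D by move: uND; rewrite inE => /andP[].
  (* With at most [J] neighbours the power of [s] is at least [sJ], so the single term at [(v, u)]
     is at least 1. *)
  case: (lerP #|nb E v :&: D|%:R J) => [few|many].
    suff : 1 <= s1 by lra.
    rewrite /s1 (bigD1 (v, u)) ?sub //= uD vD uN !mul1r.
    have : 1 <= s ^+ #|(nb E v :&: D) :\ u| / sJ.
      rewrite ler_pdivlMr // mul1r; apply: sJs; apply: le_trans few.
      by rewrite ler_nat subset_leq_card // finset.subsetDl.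
    move=> h; apply: le_trans h _; rewrite lerDl.
    by apply: sumr_ge0 => x _; exact: t0.
  case: (boolP [exists u, W u && (u \in D)]) => [/existsP [u' /andP[Wu' u'D]]|].
    suff : 1 <= s2 by lra.
    rewrite /s2 (bigD1 u') //= u'D mulr1 lerDl.
    by apply: sumr_ge0 => x _; rewrite mulr_ge0 ?ler0n.
  rewrite negb_exists => /forallP noW.
  suff : 1 <= s3 by lra.
  (* The more than [J] neighbours of [v] in [D] are all unpopular and joined to [v] by [B]; each
     pays [1 / J]. *)
  apply: (@le_trans _ _ (\sum_(x in [set (v, u') | u' in nb E v :&: D]%SET) J^-1)).
    rewrite sumr_const card_imset; last by move=> ? ? [].
    by rewrite -mulr_natl ler_pdivlMr // mul1r ltW.
  rewrite big_mkcond [leRHS]big_mkcond /=; apply: ler_sum => x _.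
  case: ifP => [/imsetP [u' u'ND ->] /=|_].
    have u'D : u' \in D by move: u'ND; rewrite inE => /andP[].
    have nWu' : ~~ W u' by have := noW u'; rewrite u'D andbT.
    by rewrite sub // nWu' u'D !mul1r.
  by case: ifP => // _; rewrite !mulr_ge0 ?ler0n ?invr_ge0 // ltW.
rewrite {1}/ndom; apply: le_trans (ler_sum _ pointwise) _.
rewrite !big_split /=; apply: lerD; first apply: lerD.
- under eq_bigr => D _ do rewrite -mulr_suml.
  rewrite -mulr_suml exchange_big /= ler_pM2r ?invr_gt0 //.
  (* The inequality [y <= lam + y ^+ 2 / lam] lets the sum over the unknown [dB] be replaced by a
     sum of squares over all pairs, whose expectation is accessible. *)
  apply: (@le_trans _ _ (\sum_(x in dB) (lam + ndom_light s E x.1 x.2 ^+ 2 / lam))).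
    apply: ler_sum => x _.
    rewrite -/(ndom_light s E x.1 x.2); set y := ndom_light _ _ _ _.
    rewrite -[X in X + _](mulfK (lt0r_neq0 lam0)) -mulrDl ler_pdivlMr //.
    have := sqr_ge0 (lam - y); have := sqr_ge0 lam; have := sqr_ge0 y; nra.
  rewrite big_split /= sumr_const; apply: lerD; first by rewrite -[leLHS]mulr_natl ler_pM2r.
  rewrite -mulr_suml ler_pM2r ?invr_gt0 // pair_big /= big_mkcond /=.
  by apply: ler_sum => x _; case: ifP => // _; rewrite sqr_ge0.
- by rewrite exchange_big /=; exact: heavy_sum_le.
- under eq_bigr => D _ do rewrite -mulr_suml.
  rewrite -mulr_suml exchange_big /= ler_pM2r ?invr_gt0 //.
  apply: (@le_trans _ _ (\sum_(x in dB) (2 * z))).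
    rewrite big_mkcondr; apply: ler_sum => x _; case: ifP => [|_].
      by rewrite -leNgt.
    by rewrite mulr_ge0 // ltW.
  by rewrite sumr_const -[leLHS]mulr_natl ler_pM2r // mulr_gt0.
Qed.

End DominatingCounts.

(** * First and second moments *)

Section Moments.
Context {R : realType} {V : finType}.
Variables (k : nat) (p : R).
Hypothesis p01 : 0 <= p <= 1.
Implicit Types (E : {set {set V}}) (D A : {set V}) (s : R).

(** Probability that a fixed vertex outside two [k]-sets has a neighbour in each of them, when they
    share [l] vertices. *)
Definition pair_dom l : R := 1 - (1 - p) ^+ k - (1 - p) ^+ k + (1 - p) ^+ (2 * k - l).

Lemma card_setU_dsets D D' : D \in dsets k -> D' \in dsets k ->
  #|D :|: D'| = (2 * k - #|D :&: D'|)%N.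
Proof. by rewrite !inE cardsU => /eqP -> /eqP ->; rewrite mul2n addnn. Qed.

Lemma dominating_sub E A D : A \subset ~: D ->
  (dominating E D)%:R <= (dominates_on E A D)%:R :> R.
Proof.
move=> AD; rewrite ler_nat dominating_dominates_on.
case: (boolP (dominates_on E (~: D) D)) => // /forall_inP h.
suff -> : dominates_on E A D by [].
by apply/forall_inP => w wA; apply: h; exact: (fintype.subsetP AD).
Qed.

Lemma bexp_ndom :
  bexp (pairs V) p (ndom k) = 'C(#|V|, k)%:R * (1 - (1 - p) ^+ k) ^+ (#|V| - k).
Proof.
rewrite /ndom bexp_sum -(card_draws V k) mulr_natl -sumr_const.
apply: eq_bigr => D; rewrite inE => /eqP cD.
rewrite -cD -(cardsC D) addKn -prob_dominates_on -?setI_eq0; last by rewrite finset.setIC finset.setICr.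
by apply: eq_bexp => E _; rewrite dominating_dominates_on.
Qed.

Definition pair_sum (phi : nat -> R) : R :=
  \sum_(D in @dsets V k) \sum_(D' in @dsets V k) phi #|D :&: D'|.

Lemma sqr_sumr (I : finType) (P : pred I) (F : I -> R) :
  (\sum_(i | P i) F i) ^+ 2 = \sum_(i | P i) \sum_(j | P j) F i * F j.
Proof. by rewrite expr2 mulr_suml; apply: eq_bigr => i _; rewrite mulr_sumr. Qed.

(** Forgetting the vertices of [D :|: D'] only enlarges the event, and the remaining vertices
    contribute independent factors. *)
Lemma bexp_dominating2 D D' : D \in dsets k -> D' \in dsets k ->
  bexp (pairs V) p (fun E => (dominating E D)%:R * (dominating E D')%:R) <=
  pair_dom #|D :&: D'| ^+ (#|V| - (2 * k - #|D :&: D'|)).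
Proof.
move=> Dk D'k; have cU := card_setU_dsets Dk D'k.
have cA : #|~: (D :|: D')| = (#|V| - (2 * k - #|D :&: D'|))%N.
  by rewrite -cU -(cardsC (D :|: D')) addKn.
have eq := @prob_dominates2_on R V D D' (~: (D :|: D')) p.
rewrite cA cU in eq; move: (Dk) (D'k); rewrite !inE => /eqP cD /eqP cD'.
rewrite cD cD' in eq; rewrite /pair_dom -eq; last first.
  by rewrite -setI_eq0 finset.setIC finset.setICr.
apply: ler_bexp => // E _; apply: ler_pM => //.
  by apply: dominating_sub; rewrite finset.setCS finset.subsetUl.
by apply: dominating_sub; rewrite finset.setCS finset.subsetUr.
Qed.

Lemma bexp_sqr_ndom :
  bexp (pairs V) p (fun E => ndom k E ^+ 2) <=
  pair_sum (fun l => pair_dom l ^+ (#|V| - (2 * k - l))).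
Proof.
rewrite (eq_bexp p (fun E _ => sqr_sumr _ _)) bexp_sum; apply: ler_sum => D Dk.
by rewrite bexp_sum; apply: ler_sum => D' D'k; exact: bexp_dominating2.
Qed.

(** After exchanging sums, each pair of sets is counted once for every common vertex [u], whence the
    factor [l]. *)
Lemma bexp_sqr_ndom_at :
  bexp (pairs V) p (fun E => \sum_u ndom_at k E u ^+ 2) <=
  pair_sum (fun l => l%:R * pair_dom l ^+ (#|V| - (2 * k - l))).
Proof.
rewrite bexp_sum.
have e u : bexp (pairs V) p (fun E => ndom_at k E u ^+ 2) =
  \sum_(D in dsets k) \sum_(D' in dsets k) (u \in D :&: D')%:R *
   bexp (pairs V) p (fun E => (dominating E D)%:R * (dominating E D')%:R).
  rewrite (eq_bexp p (fun E _ => sqr_sumr _ _)) bexp_sum; apply: eq_bigr => D Dk.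
  rewrite bexp_sum; apply: eq_bigr => D' D'k; rewrite -bexpZ; apply: eq_bexp => E _.
  by rewrite inE -mulnb natrM; ring.
under eq_bigr => u _ do rewrite e.
rewrite exchange_big /=; apply: ler_sum => D Dk; rewrite exchange_big /=.
apply: ler_sum => D' D'k; rewrite -mulr_suml.
have -> : \sum_u (u \in D :&: D')%:R = #|D :&: D'|%:R :> R.
  rewrite -natr_sum; congr (_%:R); rewrite -[RHS]sum1_card [RHS]big_mkcond.
  by apply: eq_bigr => u _; case: (u \in _).
by rewrite ler_wpM2l ?ler0n // bexp_dominating2.
Qed.

(** The star of [v] carries the weights, so [v] leaves the set of dominated vertices and the
    exponent drops by one. Since [s <= 1], counting common neighbours once instead of twice bounds
    the product of weights by a single weight over [D :|: D']. *)
Lemma bexp_light2 s D D' u v : 0 <= s <= 1 -> D \in dsets k -> D' \in dsets k ->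
  u \in D :&: D' -> v \notin D :|: D' ->
  bexp (pairs V) p (fun E =>
    ((dominating E D)%:R * ((u \in nb E v)%:R * s ^+ #|(nb E v :&: D) :\ u|)) *
    ((dominating E D')%:R * ((u \in nb E v)%:R * s ^+ #|(nb E v :&: D') :\ u|))) <=
  pair_dom #|D :&: D'| ^+ (#|V| - (2 * k - #|D :&: D'|)).-1 *
  (p * (p * s + (1 - p)) ^+ (2 * k - #|D :&: D'|).-1).
Proof.
move=> /andP[s0 s1] Dk D'k uDD' vDD'; have cU := card_setU_dsets Dk D'k.
set A := ~: (v |: (D :|: D')).
have cA : #|A| = (#|V| - (2 * k - #|D :&: D'|)).-1.
  by rewrite -cU cardsCs finset.setCK cardsU1 vDD'; lia.
have AD : A \subset ~: D.
  by rewrite finset.setCS; apply/fintype.subsetP => x xD; rewrite !inE xD orbT.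
have AD' : A \subset ~: D'.
  by rewrite finset.setCS; apply/fintype.subsetP => x xD; rewrite !inE xD !orbT.
have uU : u \in D :|: D' by move: uDD'; rewrite !inE => /andP[-> _].
have eq := @prob_dominates2_on_weighted R V D D' A p s u v.
rewrite cA cU in eq; move: (Dk) (D'k); rewrite !inE => /eqP cD /eqP cD'.
rewrite cD cD' in eq; rewrite /pair_dom -eq //; last first.
- by rewrite !inE eqxx.
- rewrite -setI_eq0; apply/eqP/setP => x; rewrite !inE.
  by case: (x == v); case: (x \in D); case: (x \in D').
apply: ler_bexp => // E _.
have -> (d d' e w w' : R) : (d * (e * w)) * (d' * (e * w')) = (d * d') * ((e * e) * (w * w')) by ring.
apply: ler_pM; rewrite ?mulr_ge0 ?ler0n ?exprn_ge0 //.
  by apply: ler_pM; rewrite ?ler0n ?dominating_sub.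
rewrite -natrM mulnb andbb ler_wpM2l ?ler0n // -exprD.
apply: ler_wiXn2l => //.
rewrite finset.setIUr finset.setDUl -cardsUI leq_addr //.
Qed.

Lemma bexp_sqr_ndom_light s : 0 <= s <= 1 ->
  bexp (pairs V) p (fun E => \sum_v \sum_u ndom_light k s E v u ^+ 2) <=
  pair_sum (fun l => #|V|%:R * l%:R * (pair_dom l ^+ (#|V| - (2 * k - l)).-1 *
     (p * (p * s + (1 - p)) ^+ (2 * k - l).-1))).
Proof.
move=> s01; rewrite bexp_sum.
pose bnd l := pair_dom l ^+ (#|V| - (2 * k - l)).-1 *
     (p * (p * s + (1 - p)) ^+ (2 * k - l).-1).
have e v u : bexp (pairs V) p (fun E => ndom_light k s E v u ^+ 2) <=
  \sum_(D in dsets k) \sum_(D' in dsets k) (u \in D :&: D')%:R *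
    ((v \notin D :|: D')%:R * bnd #|D :&: D'|).
  rewrite (eq_bexp p (fun E _ => sqr_sumr _ _)) bexp_sum; apply: ler_sum => D Dk.
  rewrite bexp_sum; apply: ler_sum => D' D'k.
  case: (boolP (u \in D :&: D')) => uDD'; last first.
    rewrite mul0r -[leRHS](bexp_cst (pairs V) p); apply: ler_bexp => // E _.
    move: uDD'; rewrite inE negb_and => /orP[] /negbTE ->; rewrite ?(mulr0, mul0r) //.
  case: (boolP (v \notin D :|: D')) => vDD'; last first.
    rewrite mul0r mulr0 -[leRHS](bexp_cst (pairs V) p); apply: ler_bexp => // E _.
    move: vDD'; rewrite inE negbK => /orP[] ->; rewrite ?(mulr0, mul0r) //.
  rewrite !mul1r; apply: le_trans (bexp_light2 s01 Dk D'k uDD' vDD').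
  apply: ler_bexp => // E _.
  move: uDD' vDD'; rewrite !inE negb_or => /andP[-> ->] /andP[-> ->].
  by rewrite !mulr1.
under eq_bigr => v _ do rewrite bexp_sum.
apply: le_trans (ler_sum _ (fun v _ => ler_sum _ (fun u _ => e v u))) _.
under eq_bigr => v _ do rewrite exchange_big /=.
rewrite exchange_big /=; apply: ler_sum => D Dk.
under eq_bigr => v _ do rewrite exchange_big /=.
rewrite exchange_big /=; apply: ler_sum => D' D'k.
have b0 : 0 <= bnd #|D :&: D'|.
  rewrite /bnd /pair_dom; case/andP: p01 => p0 p1; case/andP: s01 => s0 s1.
  have q0 : 0 <= p * s + (1 - p) by rewrite addr_ge0 ?mulr_ge0 ?subr_ge0.
  apply: mulr_ge0; last by rewrite mulr_ge0 ?exprn_ge0.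
  apply: exprn_ge0.
  have := @bexp_ge0 R V (D :|: D') p (hit2 D D') p01.
  move: (Dk) (D'k); rewrite bexp_hit2 ?finset.subsetUl ?finset.subsetUr // (card_setU_dsets Dk D'k).
  rewrite !inE => /eqP -> /eqP -> h.
  by apply: h => S _; rewrite mulr_ge0.
rewrite -/(bnd _).
under eq_bigr => v _ do rewrite -mulr_suml mulrCA.
rewrite -mulr_suml -mulrA.
have -> : \sum_u (u \in D :&: D')%:R = #|D :&: D'|%:R :> R.
  rewrite -natr_sum; congr (_%:R); rewrite -[RHS]sum1_card [RHS]big_mkcond.
  by apply: eq_bigr => u _; case: (u \in _).
apply: ler_wpM2r; first by rewrite mulr_ge0 ?ler0n.
rewrite -[X in _ <= X%:R]sum1_card natr_sum; apply: ler_sum => v _.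
by rewrite ler_nat; case: (v \notin _).
Qed.

End Moments.

Arguments pair_sum {R} V k phi.

(** * Sums over pairs of sets of size k *)

(** The ratio of the two binomials is the product of the fractions [(k - i) / (n - i)] for [i < j],
    each at most [k / n]. *)
Lemma bin_sub_le n k j : (j <= k <= n)%N ->
  ('C(n - j, k - j) * n ^ j <= k ^ j * 'C(n, k))%N.
Proof.
elim: j => [|j IH] /andP[jk kn]; first by rewrite !subn0 !expn0 muln1 mul1n.
have {}IH : ('C(n - j, k - j) * n ^ j <= k ^ j * 'C(n, k))%N by apply: IH; lia.
have diag : ((n - j) * 'C(n - j.+1, k - j.+1) = (k - j) * 'C(n - j, k - j))%N.
  have -> : (n - j.+1 = (n - j).-1)%N by lia.
  have -> : (k - j = (k - j.+1).+1)%N by lia.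
  exact: mul_bin_diag.
have step : ((k - j) * n <= k * (n - j))%N by nia.
rewrite -(@leq_pmul2l (n - j)); last by lia.
rewrite mulnA diag !expnS.
have -> : ((k - j) * 'C(n - j, k - j) * (n * n ^ j) =
  ((k - j) * n) * ('C(n - j, k - j) * n ^ j))%N by ring.
have -> : ((n - j) * (k * k ^ j * 'C(n, k)) = (k * (n - j)) * (k ^ j * 'C(n, k)))%N by ring.
exact: leq_mul.
Qed.

Section PairSum.
Context {R : realType} {V : finType}.
Variable k : nat.
Hypothesis kV : (k <= #|V|)%N.
Local Notation n := #|V|.

Lemma ler_pair_sum (phi psi : nat -> R) :
  (forall l, (l <= k)%N -> phi l <= psi l) -> pair_sum V k phi <= pair_sum V k psi.
Proof.
move=> h; apply: ler_sum => D; rewrite inE => /eqP cD; apply: ler_sum => D' _.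
by apply: h; rewrite -cD subset_leq_card // finset.subsetIl.
Qed.

Lemma pair_sumD (phi psi : nat -> R) :
  pair_sum V k (fun l => phi l + psi l) = pair_sum V k phi + pair_sum V k psi.
Proof. by rewrite -big_split; apply: eq_bigr => D _; rewrite -big_split. Qed.

Lemma pair_sumZ c (phi : nat -> R) :
  pair_sum V k (fun l => c * phi l) = c * pair_sum V k phi.
Proof. by rewrite mulr_sumr; apply: eq_bigr => D _; rewrite mulr_sumr. Qed.

Lemma pair_sum_sum m (P : pred 'I_m) (phi : 'I_m -> nat -> R) :
  pair_sum V k (fun l => \sum_(j | P j) phi j l) = \sum_(j | P j) pair_sum V k (phi j).
Proof. by rewrite exchange_big; apply: eq_bigr => D _; rewrite exchange_big. Qed.

Lemma pair_sum_bin j : (j <= k)%N ->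
  pair_sum V k (fun l => 'C(l, j)%:R : R) = ('C(n, k) * ('C(k, j) * 'C(n - j, k - j)))%:R.
Proof.
move=> jk; rewrite -sum_bin_meet ?jk // natr_sum; apply: eq_bigr => D _.
by rewrite natr_sum.
Qed.

Lemma pair_sum_bin_le j : (j <= k)%N -> (0 < n)%N ->
  pair_sum V k (fun l => 'C(l, j)%:R : R) <=
  'C(n, k)%:R ^+ 2 * ('C(k, j)%:R * (k%:R / n%:R) ^+ j).
Proof.
move=> jk n0; rewrite pair_sum_bin //.
rewrite expr_div_n !mulrA ler_pdivlMr ?exprn_gt0 ?ltr0n //.
rewrite -!natrX -!natrM ler_nat expnS expn1.
have jkn : (j <= k <= n)%N by rewrite jk.
set c := 'C(n, k); set b := 'C(k, j).
have -> : (c * (b * 'C(n - j, k - j)) * n ^ j = (c * b) * ('C(n - j, k - j) * n ^ j))%N by ring.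
have -> : (c * c * b * k ^ j = (c * b) * (k ^ j * c))%N by ring.
by rewrite leq_mul2l bin_sub_le ?orbT.
Qed.

(** The indicator of an intersection of size exactly [j] is at most ['C(l, j)], whose pair sum has a
    closed form. This is how large intersections are counted. *)
Lemma pair_sum_tail (phi main : nat -> R) :
  (forall l, (l <= k)%N -> 0 <= phi l) -> (forall l, (l <= k)%N -> 0 <= main l) ->
  (forall l, (2 * l <= k)%N -> phi l <= main l) ->
  pair_sum V k phi <= pair_sum V k main +
    \sum_(j < k.+1 | (k < 2 * j)%N) phi j * pair_sum V k (fun l => 'C(l, j)%:R).
Proof.
move=> phi0 main0 h.
under eq_bigr => j _ do rewrite -pair_sumZ.
rewrite -pair_sum_sum -pair_sumD; apply: ler_pair_sum => l lk.
have t0 (j : 'I_k.+1) : 0 <= phi j * 'C(l, j)%:R :> R.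
  by rewrite mulr_ge0 ?ler0n ?phi0 // -ltnS.
have [kl|/h hl] := ltnP k (2 * l); last first.
  by apply: le_trans hl _; rewrite lerDl sumr_ge0.
have lk1 : (l < k.+1)%N by [].
rewrite (bigD1 (Ordinal lk1)) //= binn mulr1.
by rewrite addrCA lerDl addr_ge0 ?main0 // sumr_ge0.
Qed.

End PairSum.

(** * Elementary bounds *)

Section ExpBounds.
Context {R : realType}.
Implicit Types x a p L : R.

Lemma expR_le1D2x x : 0 <= x <= 1 / 2 -> expR x <= 1 + 2 * x.
Proof.
move=> x01; have h := expR_ge1Dx (- x); rewrite expRN in h.
have e0 := expR_gt0 x.
have {}h : (1 - x) * expR x <= 1 by rewrite -ler_pdivlMr // mul1r.
by nra.
Qed.

Lemma expR_ge1B x : 1 - x <= expR (- x).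
Proof. exact: expR_ge1Dx. Qed.

Lemma expR_le1B a : 0 <= a <= 1 / 2 -> expR (- (a + 2 * a ^+ 2)) <= 1 - a.
Proof.
move=> a01; have h := expR_ge1Dx (a + 2 * a ^+ 2); rewrite expRN.
have e0 := expR_gt0 (a + 2 * a ^+ 2).
rewrite -[leLHS]mul1r ler_pdivrMr //.
apply: (@le_trans _ _ ((1 - a) * (1 + (a + 2 * a ^+ 2)))); last by rewrite ler_wpM2l //; lra.
have : 0 <= a * a * (1 - 2 * a) by rewrite !mulr_ge0 //; lra.
rewrite expr2; nra.
Qed.

Lemma bernoulli_inv p m : 0 <= p <= 1 -> (1 - p) ^+ m * (1 + p * m%:R) <= 1.
Proof.
move=> p01; elim: m => [|m IH]; first by rewrite mulr0 addr0 mulr1.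
apply: le_trans IH; rewrite exprSr -mulrA ler_wpM2l ?exprn_ge0 //; first lra.
rewrite -natr1; have : 0 <= m%:R :> R by []. by move=> m0; nra.
Qed.

Lemma bin_le_expn n m : ('C(n, m) <= n ^ m)%N.
Proof.
elim: m n => [|m IH] n; first by rewrite bin0.
case: n => [|n]; first by rewrite bin0n.
apply: (@leq_trans (m.+1 * 'C(n.+1, m.+1))); first by rewrite leq_pmull.
rewrite -mul_bin_diag expnS leq_mul2l /= (leq_trans (IH n)) //.
by case: m {IH} => // m; rewrite leq_exp2r.
Qed.

Lemma bin_le_exp2 n m : ('C(n, m) <= 2 ^ n)%N.
Proof.
elim: n m => [|n IH] [|m] //; first by rewrite bin0 expn_gt0.
by rewrite binS expnS mul2n -addnn leq_add.
Qed.

Lemma leq_expn2l_le m1 m2 e : (m1 <= m2)%N -> (m1 ^ e <= m2 ^ e)%N.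
Proof. by case: e => // e h; rewrite leq_exp2r. Qed.

(** [f] is at most [n ^ k] times the exponential of minus the left-hand side, so [1 <= f] compares
    the exponents. *)
Lemma exponent_le n k p L : expR L = n%:R -> 0 <= (1 - p) ^+ k <= 1 -> 1 <= f n k p ->
  (1 - p) ^+ k * (n - k)%:R <= k%:R * L.
Proof.
move=> eL a01 f1; set a := _ ^+ k in a01 *.
have : 1 <= expR (k%:R * L) * expR (- (a * (n - k)%:R)).
  apply: le_trans f1 _; rewrite /f -/a.
  have -> : expR (- (a * (n - k)%:R)) = expR (- a) ^+ (n - k) by rewrite -expRM_natr mulNr.
  rewrite [k%:R * L]mulrC expRM_natr eL; apply: ler_pM; rewrite ?exprn_ge0 //; first lra.
    by rewrite -natrX ler_nat bin_le_expn.
  by apply: lerXn2r; rewrite ?nnegrE ?expR_ge0 ?expR_ge1B //; lra.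
by rewrite -expRD -[leLHS]expR0 ler_expR; lra.
Qed.

End ExpBounds.

(** * Domination by two sets with a given intersection *)

(* [L] is [ln n], and [d] is the relative precision asked of the second moments. *)
Record regime (R : realType) (n k : nat) (p L eps d : R) : Prop := Regime {
  reg_p : 0 < p;
  reg_eps : 0 < eps;
  reg_epsp : eps <= 1 - p;
  reg_d : 0 < d <= 1;
  reg_L : expR L = n%:R;
  reg_L40 : 40 <= L;
  reg_k400 : (400 <= k)%N;
  reg_pk : p * k%:R <= 3 * L;
  reg_apn_le : (1 - p) ^+ k * p * n%:R <= 6 * L ^+ 2;
  reg_apn_ge : 32 * L <= (1 - p) ^+ k * p * n%:R;
  reg_big : 1000 * L ^+ 10 <= d ^+ 2 * eps * (p ^+ 3 * n%:R);
  reg_mu : n%:R ^+ 13 <= f n k p }.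

Section Regions.
Context {R : realType}.
Variables (n k : nat) (p L eps d : R).
Hypothesis reg : regime n k p L eps d.
Local Notation a := ((1 - p) ^+ k).

Let p_gt0 : 0 < p. Proof. by case: reg. Qed.
Let eps_gt0 : 0 < eps. Proof. by case: reg. Qed.
Let epsp : eps <= 1 - p. Proof. by case: reg. Qed.
Let d01 : 0 < d <= 1. Proof. by case: reg. Qed.
Let expL : expR L = n%:R. Proof. by case: reg. Qed.
Let L40 : 40 <= L. Proof. by case: reg. Qed.
Let k400 : (400 <= k)%N. Proof. by case: reg. Qed.
Let pk : p * k%:R <= 3 * L. Proof. by case: reg. Qed.
Let apn_le : a * p * n%:R <= 6 * L ^+ 2. Proof. by case: reg. Qed.
Let apn_ge : 32 * L <= a * p * n%:R. Proof. by case: reg. Qed.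
Let big : 1000 * L ^+ 10 <= d ^+ 2 * eps * (p ^+ 3 * n%:R). Proof. by case: reg. Qed.
Let mu_ge : n%:R ^+ 13 <= f n k p. Proof. by case: reg. Qed.

Let p_lt1 : p < 1. Proof. move: eps_gt0 epsp; lra. Qed.
Let n_gt0 : 0 < n%:R :> R. Proof. by rewrite -expL expR_gt0. Qed.
Let y_gt0 : 0 < p ^+ 3 * n%:R. Proof. by rewrite mulr_gt0 ?exprn_gt0. Qed.
Let a_gt0 : 0 < a. Proof. by rewrite exprn_gt0 // subr_gt0. Qed.
Let kR : 400 <= k%:R :> R. Proof. by rewrite ler_nat. Qed.

Let q_ge0 : 0 <= 1 - p. Proof. by move: p_lt1; lra. Qed.
Let L_ge0 : 0 <= L. Proof. by move: L40; lra. Qed.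
Let L3_ge0 : 0 <= 3 * L. Proof. by move: L40; lra. Qed.
Let p_ge0 : 0 <= p. Proof. exact: ltW. Qed.
Let n_ge0 : 0 <= n%:R :> R. Proof. by []. Qed.
Let a_ge0 : 0 <= a. Proof. exact: ltW. Qed.
Let pk_ge0 : 0 <= p * k%:R. Proof. by rewrite mulr_ge0. Qed.
Let apn_ge0 : 0 <= a * p * n%:R. Proof. by rewrite !mulr_ge0. Qed.
Let L62_ge0 : 0 <= 6 * L ^+ 2. Proof. by rewrite mulr_ge0 ?exprn_ge0. Qed.

Ltac slra := move: p_gt0 p_lt1 eps_gt0 epsp L40 kR n_gt0 => *; lra.

(** Common test for the error terms: times [p ^+ 3 * n], each becomes a polynomial in [a * p * n],
    [p * k] and [p], hence a power of [L], which the bound [big] outweighs. *)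
Lemma negligible (t : R) : t * (p ^+ 3 * n%:R) <= 300 * L ^+ 6 -> t <= d ^+ 2 * eps / 1000.
Proof.
move=> h; rewrite -(ler_pM2r y_gt0); apply: le_trans h _.
have L6 : 0 <= L ^+ 6 by rewrite exprn_ge0 //; slra.
have L4 : 40 ^+ 4 <= L ^+ 4 by rewrite lerXn2r ?nnegrE //; slra.
have e : L ^+ 10 = L ^+ 4 * L ^+ 6 by rewrite -exprD.
have : 40 ^+ 4 * L ^+ 6 <= L ^+ 10 by rewrite e ler_wpM2r.
move: big; nra.
Qed.

Let L_ge1 : 1 <= L. Proof. by move: L40; slra. Qed.
Let d2eps_le : d ^+ 2 * eps <= d.
Proof.
have /andP[d0 d1] := d01; rewrite expr2 -mulrA -[leRHS]mulr1 ler_wpM2l ?(ltW d0) //.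
have e1 : eps <= 1 by move: p_gt0 epsp; slra.
by rewrite -[leRHS]mulr1 ler_pM // ltW.
Qed.

Lemma akk_negligible : a * k%:R ^+ 2 <= d ^+ 2 * eps / 1000.
Proof.
apply: negligible.
have -> : a * k%:R ^+ 2 * (p ^+ 3 * n%:R) = (a * p * n%:R) * (p * k%:R) ^+ 2 by ring.
apply: (@le_trans _ _ (6 * L ^+ 2 * (3 * L) ^+ 2)).
  by apply: ler_pM; rewrite ?exprn_ge0 // lerXn2r ?nnegrE.
have -> : 6 * L ^+ 2 * (3 * L) ^+ 2 = 54 * L ^+ 4 by ring.
have : L ^+ 4 <= L ^+ 6 by rewrite ler_weXn2l.
have : 0 <= L ^+ 6 by rewrite exprn_ge0 //; slra.
slra.
Qed.

Lemma akk_small : a * k%:R ^+ 2 <= d / 1000.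
Proof. by apply: le_trans akk_negligible _; move: d2eps_le; slra. Qed.

Lemma a_le_eps : a <= eps / 1000.
Proof.
apply: (@le_trans _ _ (a * k%:R ^+ 2)).
  by rewrite -[leLHS]mulr1 ler_wpM2l // exprn_ege1 //; slra.
apply: le_trans akk_negligible _.
have /andP[d0 d1] := d01; have e0 := ltW eps_gt0.
have : d ^+ 2 * eps <= 1 * eps by rewrite ler_wpM2r // exprn_ile1 //; lra.
lra.
Qed.

Lemma k3_small : k%:R ^+ 3 <= d / 1000 * n%:R :> R.
Proof.
rewrite -ler_pdivrMr //.
apply: le_trans (_ : _ <= d ^+ 2 * eps / 1000) _; last by move: d2eps_le; slra.
apply: negligible.
have -> : k%:R ^+ 3 / n%:R * (p ^+ 3 * n%:R) = (p * k%:R) ^+ 3.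
  by field; rewrite lt0r_neq0.
apply: (@le_trans _ _ ((3 * L) ^+ 3)).
  by rewrite lerXn2r ?nnegrE.
have -> : (3 * L) ^+ 3 = 27 * L ^+ 3 by ring.
have : L ^+ 3 <= L ^+ 6 by rewrite ler_weXn2l.
have : 0 <= L ^+ 6 by rewrite exprn_ge0 //; slra.
slra.
Qed.

Lemma aanpk_small : a ^+ 2 * n%:R * p * k%:R / eps <= d / 1000.
Proof.
rewrite ler_pdivrMr //.
apply: le_trans (_ : _ <= d ^+ 2 * eps / 1000) _; last first.
  have /andP[d0 d1] := d01; have : d ^+ 2 * eps <= d * eps.
    by rewrite ler_pM2r // expr2 -[leRHS]mulr1 ler_pM2l.
  slra.
apply: negligible.
have -> : a ^+ 2 * n%:R * p * k%:R * (p ^+ 3 * n%:R) = (a * p * n%:R) ^+ 2 * (p * k%:R) * p by ring.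
apply: (@le_trans _ _ ((6 * L ^+ 2) ^+ 2 * (3 * L) * 1)).
  apply: ler_pM; rewrite ?(ltW p_lt1) ?mulr_ge0 ?exprn_ge0 //.
  by apply: ler_pM; rewrite ?exprn_ge0 // lerXn2r ?nnegrE.
have -> : (6 * L ^+ 2) ^+ 2 * (3 * L) * 1 = 108 * L ^+ 5 by ring.
have : L ^+ 5 <= L ^+ 6 by rewrite ler_weXn2l.
have : 0 <= L ^+ 6 by rewrite exprn_ge0 //; slra.
slra.
Qed.

Lemma aan_small : a ^+ 2 * n%:R <= d / 1000.
Proof.
apply: le_trans (_ : _ <= d ^+ 2 * eps / 1000) _; last by move: d2eps_le; slra.
apply: negligible.
have -> : a ^+ 2 * n%:R * (p ^+ 3 * n%:R) = (a * p * n%:R) ^+ 2 * p by ring.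
apply: (@le_trans _ _ ((6 * L ^+ 2) ^+ 2 * 1)).
  by apply: ler_pM; rewrite ?(ltW p_lt1) ?exprn_ge0 // lerXn2r ?nnegrE.
have -> : (6 * L ^+ 2) ^+ 2 * 1 = 36 * L ^+ 4 by ring.
have : L ^+ 4 <= L ^+ 6 by rewrite ler_weXn2l.
have : 0 <= L ^+ 6 by rewrite exprn_ge0 //; slra.
slra.
Qed.

Lemma a3nn_small : a ^+ 3 * n%:R ^+ 2 <= d ^+ 2 / 1000.
Proof.
apply: le_trans (_ : _ <= d ^+ 2 * eps / 1000) _; last first.
  have e1 : eps <= 1 by move: p_gt0 epsp; slra.
  have : d ^+ 2 * eps <= d ^+ 2 * 1 by rewrite ler_wpM2l ?sqr_ge0.
  slra.
apply: negligible.
have -> : a ^+ 3 * n%:R ^+ 2 * (p ^+ 3 * n%:R) = (a * p * n%:R) ^+ 3 by ring.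
apply: (@le_trans _ _ ((6 * L ^+ 2) ^+ 3)).
  by rewrite lerXn2r ?nnegrE.
have -> : (6 * L ^+ 2) ^+ 3 = 216 * L ^+ 6 by ring.
have : 0 <= L ^+ 6 by rewrite exprn_ge0 //; slra.
slra.
Qed.

Lemma ak_small : a * k%:R <= d / 1000 / k%:R.
Proof.
rewrite ler_pdivlMr; last by move: kR; slra.
by rewrite -mulrA -expr2 akk_small.
Qed.

Lemma a_le_half : a <= 1 / 2.
Proof.
have := ak_small; have /andP[d0 d1] := d01; have : d / 1000 / k%:R <= 1 / 2.
  by rewrite ler_pdivrMr; move: kR; slra.
have : a * 1 <= a * k%:R by rewrite ler_pM2l ?a_gt0 //; move: kR; slra.
slra.
Qed.

Lemma k_le_n100 : 100 * k%:R <= n%:R :> R.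
Proof.
have := k3_small; have /andP[d0 d1] := d01.
have : d / 1000 * n%:R <= 1 * n%:R by apply: ler_wpM2r; [exact: n_ge0 | lra].
have : 400 * k%:R <= k%:R ^+ 3 :> R.
  have -> : k%:R ^+ 3 = (k%:R * k%:R) * k%:R :> R by ring.
  by apply: ler_wpM2r; [exact: ler0n | move: kR; nra].
have := kR; lra.
Qed.

Let k_lt_n : (2 * k < n)%N.
Proof. rewrite -(ltr_nat R) natrM; have := k_le_n100; have := kR; slra. Qed.

Lemma pair_domE l : (l <= k)%N -> pair_dom k p l = 1 - a - a + a * (1 - p) ^+ (k - l).
Proof.
move=> lk; have e : (2 * k - l = k + (k - l))%N by clear -lk; lia.
by rewrite /pair_dom e exprD.
Qed.

Lemma pair_dom_ge l : (l <= k)%N -> (1 - a) ^+ 2 <= pair_dom k p l.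
Proof.
move=> lk; rewrite pair_domE //.
have : a <= (1 - p) ^+ (k - l) by rewrite ler_wiXn2l ?leq_subr //; slra.
have a0 := a_gt0; nra.
Qed.

Lemma pair_dom_gen l : (l <= k)%N ->
  pair_dom k p l ^+ (n - (2 * k - l)) <=
  (1 - a) ^+ (2 * (n - k)) *
  expR (4 * a * ((1 - p) ^+ (k - l) - a) * n%:R + 4 * (a * k%:R)).
Proof.
move=> lk; set Q := (1 - p) ^+ (k - l); set m := (k - l)%N.
have aQ : a <= Q by rewrite ler_wiXn2l ?leq_subr //; slra.
have a0 := a_gt0; have a2 := a_le_half.
have -> : (n - (2 * k - l) = n - k - m)%N by rewrite /m; clear -lk; lia.
have P0 : 0 <= pair_dom k p l by apply: le_trans (pair_dom_ge lk); rewrite sqr_ge0.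
have : pair_dom k p l <= (1 - a) ^+ 2 * expR (4 * a * (Q - a)).
  apply: (@le_trans _ _ ((1 - a) ^+ 2 * (1 + 4 * a * (Q - a)))); last first.
    by rewrite ler_wpM2l ?sqr_ge0 ?expR_ge1Dx.
  rewrite pair_domE // -/Q.
  have h : 0 <= 4 * (1 - a) ^+ 2 - 1 by nra.
  have aQa : 0 <= a * (Q - a) by rewrite mulr_ge0 // subr_ge0.
  by have := mulr_ge0 aQa h; nra.
move=> /(lerXn2r (n - k - m) _ _) => /(_ P0).
rewrite nnegrE mulr_ge0 ?sqr_ge0 ?expR_ge0 // => /(_ isT) h; apply: le_trans h _.
rewrite exprMn -expRM_natr -exprM expRD.
have e1 : expR (4 * a * (Q - a) * (n - k - m)%:R) <= expR (4 * a * (Q - a) * n%:R).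
  rewrite ler_expR ler_wpM2l ?mulr_ge0 ?subr_ge0 ?(ltW a0) //.
  by rewrite ler_nat; clear; lia.
have e2 : (1 - a) ^+ (2 * (n - k - m)) <= (1 - a) ^+ (2 * (n - k)) * expR (4 * (a * k%:R)).
  have -> : (2 * (n - k) = 2 * (n - k - m) + 2 * m)%N by rewrite /m; move: k_lt_n; clear -lk; lia.
  rewrite exprD -mulrA -[leLHS]mulr1 ler_wpM2l ?exprn_ge0 //; first slra.
  apply: (@le_trans _ _ ((1 - a) ^+ (2 * m) * expR (2 * a) ^+ (2 * m))).
    rewrite -exprMn exprn_ege1 //.
    have := expR_ge1Dx (2 * a).
    have : 0 <= a * (1 - 2 * a) by rewrite mulr_ge0 //; lra.
    move=> h1 h2; apply: (@le_trans _ _ ((1 - a) * (1 + 2 * a))); first nra.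
    by rewrite ler_wpM2l //; slra.
  rewrite ler_wpM2l ?exprn_ge0 //; first slra.
  rewrite -expRM_natr ler_expR natrM.
  have : m%:R <= k%:R :> R by rewrite ler_nat leq_subr.
  nra.
rewrite mulrC; apply: le_trans (ler_pM _ _ e1 e2) _; rewrite ?expR_ge0 ?exprn_ge0 //.
  by lra.
by rewrite le_eqVlt; apply/orP; left; apply/eqP; ring.
Qed.

(** Here [Q ^+ 2 <= a], so the square of the correlation term [a * Q * n] is at most
    [a ^+ 3 * n ^+ 2], which [a3nn_small] controls. *)
Lemma pair_dom_half l : (2 * l <= k)%N ->
  pair_dom k p l ^+ (n - (2 * k - l)) <= (1 - a) ^+ (2 * (n - k)) * (1 + d / 2).
Proof.
move=> lk2; have lk : (l <= k)%N by clear -lk2; lia.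
have a2 := a_le_half; have /andP[d0 d1] := d01.
apply: le_trans (pair_dom_gen lk) _; apply: ler_wpM2l; first by rewrite exprn_ge0 //; lra.
set Q := (1 - p) ^+ (k - l).
have Q0 : 0 <= Q by rewrite exprn_ge0.
have QQ : Q ^+ 2 <= a.
  rewrite -exprM ler_wiXn2l //; first slra.
  by clear -lk2; lia.
have aQn0 : 0 <= a * Q * n%:R by rewrite !mulr_ge0.
have aQn : a * Q * n%:R <= d / 30.
  rewrite -(@ler_pXn2r _ 2) ?nnegrE //; last by lra.
  have -> : (a * Q * n%:R) ^+ 2 = Q ^+ 2 * (a * n%:R) ^+ 2 by ring.
  apply: (@le_trans _ _ (a * (a * n%:R) ^+ 2)); first by rewrite ler_wpM2r ?sqr_ge0.
  have -> : a * (a * n%:R) ^+ 2 = a ^+ 3 * n%:R ^+ 2 by ring.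
  apply: le_trans a3nn_small _; rewrite expr_div_n.
  have : 0 <= d ^+ 2 by rewrite sqr_ge0.
  lra.
have ak : a * k%:R <= d / 1000.
  apply: le_trans ak_small _; rewrite ler_pdivrMr; last by slra.
  rewrite ler_peMr; [by []| lra | slra].
have aan0 : 0 <= a ^+ 2 * n%:R by rewrite mulr_ge0 ?exprn_ge0.
apply: (@le_trans _ _ (expR (d / 4))).
  by rewrite ler_expR; nra.
by apply: le_trans (expR_le1D2x _) _; lra.
Qed.

(** For [l = 1], [Q - a = p * Q] with [a = (1 - p) * Q], an extra factor [p]. The resulting error
    [d / k], sharper than [d / 2], is what the variance of the counts at single vertices
    requires. *)
Lemma pair_dom_le1 l : (l <= 1)%N ->
  pair_dom k p l ^+ (n - (2 * k - l)) <= (1 - a) ^+ (2 * (n - k)) * (1 + d / k%:R).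
Proof.
move=> l1; have lk : (l <= k)%N by apply: leq_trans l1 (leq_trans _ k400).
have a2 := a_le_half; have /andP[d0 d1] := d01.
apply: le_trans (pair_dom_gen lk) _; apply: ler_wpM2l; first by rewrite exprn_ge0 //; lra.
set Q := (1 - p) ^+ (k - l).
have Qa : Q - a <= p * a / eps.
  case: l l1 lk @Q => [|[|//]] _ lk Q; rewrite /Q.
    by rewrite subn0 subrr !mulr_ge0 // invr_ge0 ltW.
  have ea : a = (1 - p) * Q by rewrite -exprS -addn1 subnK.
  have Q0 : 0 <= Q by rewrite exprn_ge0.
  rewrite -/Q ler_pdivlMr // ea -subr_ge0.
  have -> : p * ((1 - p) * Q) - (Q - (1 - p) * Q) * eps = p * Q * (1 - p - eps) by ring.
  by rewrite !mulr_ge0 // subr_ge0.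
have k0 : 0 < k%:R :> R by slra.
have h1 : 4 * a * (Q - a) * n%:R <= 4 * (d / 1000 / k%:R).
  apply: (@le_trans _ _ (4 * (a ^+ 2 * n%:R * p / eps))).
    have -> : 4 * (a ^+ 2 * n%:R * p / eps) = 4 * a * n%:R * (p * a / eps) by ring.
    by rewrite mulrAC ler_wpM2l // !mulr_ge0.
  rewrite ler_pM2l ?ltr0n // ler_pdivlMr //.
  by apply: le_trans aanpk_small; rewrite le_eqVlt; apply/orP; left; apply/eqP; ring.
have h2 := ak_small.
have dk : 0 <= d / k%:R <= 1 / 2.
  apply/andP; split; first by apply: divr_ge0; exact: ltW.
  by rewrite ler_pdivrMr //; slra.
apply: (@le_trans _ _ (expR (8 * (d / 1000 / k%:R)))).
  by rewrite ler_expR; lra.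
by apply: le_trans (expR_le1D2x _) _; lra.
Qed.

(* [D'] is obtained from [D] by exchanging [k - l <= 3 / p] vertices: given that
   [D] dominates, each exchange costs a factor exponentially small in [a * p * n],
   which is at least [32 * L], and this beats its [n ^ 2] choices. *)
Lemma tail_near l : (l <= k)%N -> p * (k - l)%:R <= 3 ->
  pair_dom k p l ^+ (n - (2 * k - l)) * ('C(k, l) * 'C(n - l, k - l))%:R <=
  (1 - a) ^+ (n - k).
Proof.
move=> lk; set m := (k - l)%N => pm3; set Q := (1 - p) ^+ m.
have a2 := a_le_half; have kn := k_le_n100; have k2n := k_lt_n.
have -> : (n - (2 * k - l) = n - k - m)%N by rewrite /m; clear -lk; lia.
have mk : (m <= k)%N by rewrite leq_subr.
set e := (n - k - m)%N.
have Qa : a <= Q by rewrite ler_wiXn2l //; slra.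
have Q1 : Q <= 1 by rewrite exprn_ile1 //; slra.
have P0 : 0 <= pair_dom k p l by apply: le_trans (pair_dom_ge lk); rewrite sqr_ge0.
have Pe : pair_dom k p l ^+ e <= (1 - a) ^+ e * expR (- (a * (1 - Q) * e%:R)).
  have -> : - (a * (1 - Q) * e%:R) = - (a * (1 - Q)) * e%:R by ring.
  rewrite expRM_natr -exprMn; apply: lerXn2r; rewrite ?nnegrE ?mulr_ge0 ?expR_ge0 //; first by lra.
  apply: (@le_trans _ _ ((1 - a) * (1 - a * (1 - Q)))); last first.
    by rewrite ler_wpM2l ?expR_ge1B //; lra.
  rewrite pair_domE // -/m -/Q.
  have : 0 <= a ^+ 2 * (1 - Q) by rewrite mulr_ge0 ?sqr_ge0 ?subr_ge0.
  by nra.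
have half : (1 - a) ^+ e <= (1 - a) ^+ (n - k) * 2 ^+ m.
  have -> : (n - k = e + m)%N by rewrite /e; clear -mk k2n; lia.
  rewrite exprD -mulrA -exprMn -[leLHS]mulr1 ler_wpM2l ?exprn_ge0 ?exprn_ege1 //; lra.
have binle : ('C(k, l) * 'C(n - l, k - l))%:R <= n%:R ^+ m * n%:R ^+ m :> R.
  rewrite -!natrX -natrM ler_nat -bin_sub // -/m leq_mul //.
    apply: leq_trans (bin_le_expn _ _) _; apply: leq_expn2l_le; clear -k2n; lia.
  apply: leq_trans (bin_le_expn _ _) _; apply: leq_expn2l_le; clear -k2n; lia.
have mR : 0 <= m%:R :> R by [].
(* The choices cost at most [expR (3 * L * m)]. As [p * m <= 3], Bernoulli gives
   [1 - Q >= p * m / 4], and with [e >= 9 / 10 * n] the exponential gains at least [7 * L * m]. *)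
have one : 2 ^+ m * (n%:R ^+ m * n%:R ^+ m) * expR (- (a * (1 - Q) * e%:R)) <= 1.
  apply: (@le_trans _ _ (n%:R ^+ m * (n%:R ^+ m * n%:R ^+ m) * expR (- (a * (1 - Q) * e%:R)))).
    apply: ler_wpM2r; first exact: expR_ge0.
    apply: ler_wpM2r; first by rewrite mulr_ge0 ?exprn_ge0.
    by rewrite lerXn2r ?nnegrE //; slra.
  rewrite -expL -!expRM_natr -!expRD -[leRHS]expR0 ler_expR.
  have := bernoulli_inv m (_ : 0 <= p <= 1); rewrite -/Q => /(_ _) bern.
  have {}bern : Q * (1 + p * m%:R) <= 1 by apply: bern; slra.
  have x0 : 0 <= p * m%:R by rewrite mulr_ge0.
  have Qx : p * m%:R <= 4 * (1 - Q) by nra.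
  have eR : e%:R = n%:R - k%:R - m%:R :> R.
    by rewrite -natrB ?natrB //; clear -mk k2n; lia.
  have en : (9 / 10) * n%:R <= e%:R :> R.
    have : m%:R <= k%:R :> R by rewrite ler_nat.
    by move: kn; rewrite eR; lra.
  have h1 : a * (p * m%:R) * e%:R <= a * (4 * (1 - Q)) * e%:R.
    by apply: ler_wpM2r => //; exact: ler_wpM2l.
  have h2 : a * (p * m%:R) * ((9 / 10) * n%:R) <= a * (p * m%:R) * e%:R.
    by apply: ler_wpM2l => //; exact: mulr_ge0.
  have h3 : 32 * L * m%:R <= a * p * n%:R * m%:R by exact: ler_wpM2r.
  have h4 : 0 <= L * m%:R by exact: mulr_ge0.
  lra.
have q0 : 0 <= (1 - a) ^+ (n - k) by rewrite exprn_ge0 //; lra.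
apply: le_trans (ler_pM _ _ Pe binle) _; rewrite ?exprn_ge0 //.
apply: (@le_trans _ _ ((1 - a) ^+ (n - k) * 2 ^+ m * expR (- (a * (1 - Q) * e%:R)) * (n%:R ^+ m * n%:R ^+ m))).
  apply: ler_wpM2r; first by rewrite mulr_ge0 ?exprn_ge0.
  by apply: ler_wpM2r => //; exact: expR_ge0.
rewrite -[leRHS]mulr1.
apply: le_trans (ler_wpM2l q0 one); rewrite le_eqVlt; apply/orP; left; apply/eqP; ring.
Qed.

Local Notation mu := (f n k p).

Let n_ge1 : 1 <= n%:R :> R.
Proof. by have := k_le_n100; slra. Qed.

Let mu_gt0 : 0 < mu.
Proof. by apply: lt_le_trans mu_ge; rewrite exprn_gt0. Qed.

Lemma an_le : a * (n - k)%:R <= k%:R * L.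
Proof.
have a2 := a_le_half; apply: exponent_le => //; first by apply/andP; split=> //; lra.
by apply: le_trans mu_ge; rewrite exprn_ege1.
Qed.

(** Now [Q <= 1 / 4], so correlation costs at most [k * L / 4] in the exponent. Since [k ^+ 3 <= n]
    and [l >= k / 2], the factor [(k / n) ^+ l] gains [k * L / 3]; the surplus [k * L / 12] covers
    ['C(k, l)], [n ^+ 10] and the lower-order terms. *)
Lemma tail_far l : (l <= k)%N -> (k <= 2 * l)%N -> 3 <= p * (k - l)%:R ->
  pair_dom k p l ^+ (n - (2 * k - l)) * ('C(k, l)%:R * (k%:R / n%:R) ^+ l) <=
  (1 - a) ^+ (2 * (n - k)) / n%:R ^+ 10.
Proof.
move=> lk kl; set m := (k - l)%N => pm3; set Q := (1 - p) ^+ m.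
have a2 := a_le_half; have kn := k_le_n100; have k2n := k_lt_n.
have -> : (n - (2 * k - l) = n - k - m)%N by rewrite /m; clear -lk; lia.
have mk : (m <= k)%N by rewrite leq_subr.
set e := (n - k - m)%N; set N := (n - k)%N.
have Q0 : 0 <= Q by rewrite exprn_ge0.
have P0 : 0 <= pair_dom k p l by apply: le_trans (pair_dom_ge lk); rewrite sqr_ge0.
have Pe : pair_dom k p l ^+ e <= expR ((- (2 * a) + a * Q) * e%:R).
  rewrite expRM_natr; apply: lerXn2r; rewrite ?nnegrE ?expR_ge0 //.
  by apply: le_trans (expR_ge1Dx _); rewrite pair_domE // -/m -/Q; lra.
have Qle : Q <= 1 / 4.
  have p01 : 0 <= p <= 1 by slra.
  have := bernoulli_inv m p01; rewrite -/Q; nra.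
have binle : 'C(k, l)%:R <= expR k%:R :> R.
  apply: (@le_trans _ _ (2 ^+ k)); first by rewrite -natrX ler_nat bin_le_exp2.
  rewrite -[k%:R]mul1r expRM_natr; apply: lerXn2r; rewrite ?nnegrE ?expR_ge0 //.
  by have := expR_ge1Dx (1 : R); lra.
have kn23 : k%:R / n%:R <= expR (- (2 / 3 * L)).
  rewrite -(@ler_pXn2r _ 3) ?nnegrE ?expR_ge0 ?divr_ge0 //.
  rewrite -expRM_natr.
  have -> : - (2 / 3 * L) * 3 = - (L * 2) by field.
  rewrite expRN expRM_natr expL expr_div_n ler_pdivrMr ?exprn_gt0 //.
  rewrite (exprSr n%:R 2) mulKf ?expf_neq0 ?lt0r_neq0 //.
  have := k3_small; have /andP[d0 d1] := d01.
  have : d / 1000 * n%:R <= 1 * n%:R by apply: ler_wpM2r; [exact: n_ge0 | lra].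
  lra.
have knl : (k%:R / n%:R) ^+ l <= expR (- (k%:R * L / 3)).
  apply: (@le_trans _ _ (expR (- (2 / 3 * L) * l%:R))).
    by rewrite expRM_natr; apply: lerXn2r; rewrite ?nnegrE ?expR_ge0 ?divr_ge0.
  rewrite ler_expR; have : k%:R <= 2 * l%:R :> R by rewrite -natrM ler_nat.
  by move=> h; have := ler_wpM2r L_ge0 h; lra.
have lower : expR (- (2 * (a + 2 * a ^+ 2)) * N%:R) <= (1 - a) ^+ (2 * N).
  have -> : - (2 * (a + 2 * a ^+ 2)) * N%:R = - (a + 2 * a ^+ 2) * (2 * N)%:R.
    by rewrite natrM; ring.
  rewrite expRM_natr; apply: lerXn2r; rewrite ?nnegrE ?expR_ge0 ?expR_le1B //; first lra.
  by rewrite a_ge0 a2.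
rewrite ler_pdivlMr ?exprn_gt0 //; apply: le_trans lower.
apply: (@le_trans _ _ (expR ((- (2 * a) + a * Q) * e%:R) *
   (expR k%:R * expR (- (k%:R * L / 3))) * expR (L * 10%:R))).
  rewrite expRM_natr expL; apply: ler_wpM2r; first exact: exprn_ge0.
  apply: ler_pM; rewrite ?mulr_ge0 ?exprn_ge0 ?divr_ge0 //.
  by apply: ler_pM; rewrite ?exprn_ge0 ?divr_ge0.
rewrite -!expRD ler_expR.
have eN : e%:R = N%:R - m%:R :> R.
  by rewrite -natrB //; move: k2n mk; rewrite /N; clear; lia.
have Nn : N%:R <= n%:R :> R by rewrite ler_nat leq_subr.
have mR : m%:R <= k%:R :> R by rewrite ler_nat.
have m0 : 0 <= m%:R :> R by [].
have e0 : 0 <= e%:R :> R by [].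
have ak : a * k%:R <= 1.
  apply: le_trans ak_small _; have /andP[d0 d1] := d01.
  by rewrite ler_pdivrMr; slra.
have am : a * m%:R <= 1 by apply: le_trans ak; exact: ler_wpM2l.
have aN := an_le; rewrite -/N in aN.
have aQe : a * Q * e%:R <= k%:R * L / 4.
  apply: (@le_trans _ _ (a * (1 / 4) * N%:R)); last by lra.
  apply: ler_pM => //; rewrite ?mulr_ge0 //; last by rewrite eN; lra.
  by apply: ler_wpM2l.
have aaN : a ^+ 2 * N%:R <= 1 / 1000.
  apply: le_trans (_ : _ <= a ^+ 2 * n%:R) _; first by apply: ler_wpM2l; rewrite ?exprn_ge0.
  by apply: le_trans aan_small _; have /andP[d0 d1] := d01; lra.
have kL1 : 400 * L <= k%:R * L by apply: ler_wpM2r.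
have kL2 : k%:R * 40 <= k%:R * L by apply: ler_wpM2l; rewrite ?ler0n.
have aeN : a * e%:R = a * N%:R - a * m%:R by rewrite eN mulrBr.
move: kR L40 => *; lra.
Qed.

(** For [p * (k - l) <= 3] the bound obtained is [mu], which is at most [mu ^+ 2 / n ^+ 10] because
    [mu >= n ^+ 13]; the other case is [tail_far]. *)
Lemma tail_le l : (l <= k)%N -> (k < 2 * l)%N ->
  pair_dom k p l ^+ (n - (2 * k - l)) * pair_sum 'I_n k (fun j => 'C(j, l)%:R) <=
  mu ^+ 2 / n%:R ^+ 10.
Proof.
move=> lk kl; have a2 := a_le_half; have k2n := k_lt_n.
have P0 : 0 <= pair_dom k p l by apply: le_trans (pair_dom_ge lk); rewrite sqr_ge0.
have kn : (k <= #|'I_n|)%N by rewrite card_ord; clear -k2n; lia.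
case: (lerP (p * (k - l)%:R) 3) => pm3.
  rewrite pair_sum_bin // card_ord natrM mulrCA.
  apply: (@le_trans _ _ mu).
    by rewrite ler_wpM2l // tail_near.
  rewrite ler_pdivlMr ?exprn_gt0 // expr2 ler_pM2l //.
  by apply: le_trans mu_ge; rewrite ler_weXn2l.
have n0 : (0 < #|'I_n|)%N by rewrite card_ord; clear -k2n; lia.
have := @pair_sum_bin_le R 'I_n k kn l lk n0; rewrite card_ord => h.
apply: le_trans (ler_wpM2l _ h) _; first by rewrite exprn_ge0.
have C0 : 0 <= 'C(n, k)%:R ^+ 2 :> R by rewrite exprn_ge0.
have := ler_wpM2l C0 (tail_far lk (ltnW kl) (ltW pm3)).
rewrite mulrCA => {}h; apply: le_trans h _.
by rewrite /mu exprMn -exprM [(_ * 2)%N]mulnC !mulrA.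
Qed.

End Regions.

(** * Second moments of the counts of dominating sets *)

Section SecondMoments.
Context {R : realType}.
Variables (n k : nat) (p L eps d : R).
Hypothesis reg : regime n k p L eps d.
Local Notation a := ((1 - p) ^+ k).
Local Notation mu := (f n k p).
Local Notation phi := (fun l : nat => pair_dom k p l ^+ (n - (2 * k - l))).
Local Notation psum := (pair_sum 'I_n k).

Lemma reg_k2n : (2 * k < n)%N.
Proof.
rewrite -(ltr_nat R) natrM; have := k_le_n100 reg.
have : 400 <= k%:R :> R by rewrite ler_nat; case: reg.
lra.
Qed.

Lemma reg_nd : 1000 <= d * n%:R.
Proof.
case: reg => p0 e0 ep /andP[d0 d1] eL L40 _ _ _ _ big _.
have n0 : 0 < n%:R :> R by rewrite -eL expR_gt0.
have L1 : 1 <= L ^+ 10 by rewrite exprn_ege1 //; lra.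
have : d ^+ 2 * eps * (p ^+ 3 * n%:R) <= d * n%:R.
  rewrite mulrA ler_pM2r // -mulrA expr2 -mulrA -[leRHS]mulr1 ler_pM2l //.
  have p3 : p ^+ 3 <= 1 by rewrite exprn_ile1 //; lra.
  have p30 : 0 <= p ^+ 3 by rewrite exprn_ge0 // ltW.
  have : eps * p ^+ 3 <= 1 * 1 by apply: ler_pM => //; lra.
  have : 0 <= eps * p ^+ 3 by rewrite mulr_ge0 // ltW.
  nra.
lra.
Qed.

Lemma pair_dom_ge0 l : (l <= k)%N -> 0 <= pair_dom k p l.
Proof. by move=> lk; apply: le_trans (pair_dom_ge reg lk); rewrite sqr_ge0. Qed.

Lemma psum_cst (c : R) : psum (fun=> c) = 'C(n, k)%:R ^+ 2 * c.
Proof.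
rewrite /pair_sum !sumr_const card_draws card_ord -mulrnA -[LHS]mulr_natl.
by rewrite natrM expr2.
Qed.

Lemma muE : mu ^+ 2 = 'C(n, k)%:R ^+ 2 * (1 - a) ^+ (2 * (n - k)).
Proof. by rewrite /f exprMn -exprM mulnC. Qed.

Let kn : (k <= #|'I_n|)%N. Proof. by rewrite card_ord; have := reg_k2n; clear; lia. Qed.
Let n0 : (0 < #|'I_n|)%N. Proof. by rewrite card_ord; have := reg_k2n; clear; lia. Qed.

(** There are at most [k + 1 <= n] terms, which uses one of the ten powers of [n] in [tail_le]. *)
Lemma tail_sum_le (g : nat -> R) G : (forall l, (l <= k)%N -> 0 <= g l <= G) ->
  \sum_(j < k.+1 | (k < 2 * j)%N) g j * phi j * psum (fun l => 'C(l, j)%:R) <=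
  mu ^+ 2 * (G / n%:R ^+ 9).
Proof.
move=> gG; have nR : 0 < n%:R :> R by case: reg => _ _ _ _ <- *; rewrite expR_gt0.
have G0 : 0 <= G by have /andP[] := gG 0%N isT; exact: le_trans.
apply: (@le_trans _ _ (\sum_(j < k.+1 | (k < 2 * j)%N) G * (mu ^+ 2 / n%:R ^+ 10))).
  apply: ler_sum => j kj; have jk : (j <= k)%N by rewrite -ltnS.
  have /andP[g0 gle] := gG j jk; rewrite -mulrA; apply: ler_pM => //.
    by rewrite mulr_ge0 ?exprn_ge0 ?pair_dom_ge0 // !sumr_ge0 // => D _; rewrite sumr_ge0.
  exact: (tail_le reg jk kj).
apply: (@le_trans _ _ (\sum_(j < k.+1) G * (mu ^+ 2 / n%:R ^+ 10))).
  rewrite big_mkcond; apply: ler_sum => j _; case: ifP => // _.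
  by rewrite mulr_ge0 // divr_ge0 ?sqr_ge0 ?exprn_ge0.
rewrite sumr_const card_ord -[leLHS]mulr_natl.
have kn1 : k.+1%:R <= n%:R :> R by rewrite ler_nat; have := reg_k2n; clear; lia.
have -> : mu ^+ 2 * (G / n%:R ^+ 9) = n%:R * (G * (mu ^+ 2 / n%:R ^+ 10)).
  by field; rewrite lt0r_neq0.
by rewrite ler_wpM2r // mulr_ge0 // divr_ge0 ?sqr_ge0 ?exprn_ge0.
Qed.

Lemma sum_phi : psum phi <= mu ^+ 2 * (1 + d).
Proof.
have d01 : 0 < d <= 1 by case: reg.
have nR : 0 < n%:R :> R by case: reg => _ _ _ _ <- *; rewrite expR_gt0.
have n1 : 1 <= n%:R :> R by rewrite ler1n; have := reg_k2n; clear; lia.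
have a2 := a_le_half reg.
have w0 : 0 <= (1 - a) ^+ (2 * (n - k)) by rewrite exprn_ge0 //; lra.
have := @pair_sum_tail R 'I_n k phi (fun=> (1 - a) ^+ (2 * (n - k)) * (1 + d / 2)).
move=> /(_ _ _ _) h; apply: le_trans (h _ _ _) _.
- by move=> l lk; rewrite exprn_ge0 ?pair_dom_ge0.
- by move=> l lk; rewrite mulr_ge0 //; lra.
- by move=> l lk; exact: (pair_dom_half reg lk).
rewrite psum_cst mulrA -muE.
have := @tail_sum_le (fun=> 1) 1 _; under eq_bigr => j _ do rewrite mul1r.
move=> h2; apply: le_trans (lerD (lexx _) (h2 _)) _; first by move=> *; rewrite ler01 lexx.
rewrite -mulrDr ler_wpM2l ?sqr_ge0 //.
have : 1 / n%:R ^+ 9 <= d / 2.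
  rewrite ler_pdivrMr ?exprn_gt0 //.
  have : n%:R <= n%:R ^+ 9 :> R by rewrite -[leLHS]expr1 ler_weXn2l.
  by have := reg_nd; nra.
lra.
Qed.

Lemma bin1R l : 'C(l, 1)%:R = l%:R :> R. Proof. by rewrite bin1. Qed.

Lemma bin2R l : 2 * 'C(l, 2)%:R = l%:R * (l%:R - 1) :> R.
Proof.
case: l => [|l]; first by rewrite bin0n mulr0 mul0r.
by rewrite -natrM -[in RHS]natr1 addrK natr1 -mul_bin_diag /= bin1 natrM.
Qed.

(** For two uniform [k]-sets the intersection size [l] has mean [k ^+ 2 / n], and [l * (l - 1)],
    which is [2 * 'C(l, 2)], has mean at most [k ^+ 4 / n ^+ 2]. *)
Lemma psum_lin (c1 c2 w : R) : 0 <= c1 -> 0 <= c2 -> 0 <= w ->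
  psum (fun l => w * (c1 * 'C(l, 1)%:R + c2 * (2 * 'C(l, 2)%:R))) <=
  'C(n, k)%:R ^+ 2 * w * (c1 * (k%:R ^+ 2 / n%:R) + c2 * (k%:R ^+ 4 / n%:R ^+ 2)).
Proof.
move=> c10 c20 w0; have k400 : (400 <= k)%N by case: reg.
have k2 : (2 <= k)%N by apply: leq_trans k400. have k1 : (1 <= k)%N by apply: ltnW.
have nR : 0 < n%:R :> R by case: reg => _ _ _ _ <- *; rewrite expR_gt0.
have C0 : 0 <= 'C(n, k)%:R ^+ 2 :> R by rewrite exprn_ge0.
have b1 := @pair_sum_bin_le R 'I_n k kn 1 k1 n0.
have b2 := @pair_sum_bin_le R 'I_n k kn 2 k2 n0.
rewrite pair_sumZ pair_sumD !pair_sumZ mulrAC mulrC ler_wpM2r // mulrDr.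
apply: lerD.
  rewrite mulrCA ler_wpM2l //; apply: le_trans b1 _.
  rewrite card_ord bin1 le_eqVlt; apply/orP; left; apply/eqP.
  by field; rewrite lt0r_neq0.
rewrite [leRHS]mulrCA ler_wpM2l // -ler_pdivlMl //; apply: le_trans b2 _.
rewrite card_ord [leRHS]mulrCA ler_wpM2l //.
have h : 2 * 'C(k, 2)%:R <= k%:R ^+ 2 :> R.
  by rewrite bin2R expr2 ler_wpM2l // gerBl.
rewrite ler_pdivlMl // mulrA.
have -> : k%:R ^+ 4 / n%:R ^+ 2 = k%:R ^+ 2 * (k%:R / n%:R) ^+ 2 :> R.
  by field; rewrite lt0r_neq0.
by rewrite ler_wpM2r ?sqr_ge0.
Qed.

(** The relative error has to be of order [d / k]. Intersections of size 1 meet it by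
    [pair_dom_le1]; larger ones are rarer by a factor of order [k ^+ 2 / n], so a constant-factor
    bound suffices there. *)
Lemma sum_l_phi :
  psum (fun l => l%:R * phi l) <= mu ^+ 2 * (k%:R ^+ 2 / n%:R * (1 + 3 * d / k%:R)).
Proof.
have d01 : 0 < d <= 1 by case: reg.
have nR : 0 < n%:R :> R by case: reg => _ _ _ _ <- *; rewrite expR_gt0.
have k400 : 400 <= k%:R :> R by rewrite ler_nat; case: reg.
have kR : 0 < k%:R :> R by lra.
have n1 : 1 <= n%:R :> R by rewrite ler1n; have := reg_k2n; clear; lia.
have a2 := a_le_half reg.
have w0 : 0 <= (1 - a) ^+ (2 * (n - k)) by rewrite exprn_ge0 //; lra.
have dk0 : 0 <= 1 + d / k%:R by rewrite addr_ge0 // divr_ge0 //; lra.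
set main := fun l : nat => (1 - a) ^+ (2 * (n - k)) *
   ((1 + d / k%:R) * 'C(l, 1)%:R + 2 * (2 * 'C(l, 2)%:R)) : R.
have := @pair_sum_tail R 'I_n k (fun l => l%:R * phi l) main.
move=> /(_ _ _ _) h; apply: le_trans (h _ _ _) _.
- by move=> l lk; rewrite mulr_ge0 // exprn_ge0 ?pair_dom_ge0.
- by move=> l lk; rewrite /main mulr_ge0 // addr_ge0 // !mulr_ge0.
- move=> l lk; rewrite /main bin2R bin1R.
  (* For [l >= 2], [l <= l * (l - 1)] moves the cruder bound into the second factorial moment, which
     vanishes at [l <= 1]. *)
  case: (leqP l 1) => l1.
    have h1 := pair_dom_le1 reg l1.
    apply: le_trans (ler_wpM2l (ler0n _ l) h1) _.
    rewrite mulrCA ler_wpM2l // mulrC lerDl mulr_ge0 //.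
    by case: l l1 {lk h1} => [|[|]] // _; rewrite ?mul0r ?subrr ?mulr0.
  have h1 := pair_dom_half reg lk.
  apply: le_trans (ler_wpM2l (ler0n _ l) h1) _.
  rewrite mulrCA ler_wpM2l //.
  have l2 : 2 <= l%:R :> R by rewrite ler_nat.
  have : 0 <= (1 + d / k%:R) * l%:R by rewrite mulr_ge0.
  nra.
apply: le_trans (lerD (psum_lin dk0 _ w0) (@tail_sum_le (fun l => l%:R) k%:R _)) _ => //.
  by move=> l lk; rewrite ler0n ler_nat.
rewrite -muE -mulrDr ler_wpM2l ?sqr_ge0 //.
have t1 : 2 * (k%:R ^+ 4 / n%:R ^+ 2) <= d * k%:R / n%:R.
  have := k3_small reg => k3.
  rewrite mulrA ler_pdivrMr ?exprn_gt0 //.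
  have -> : d * k%:R / n%:R * n%:R ^+ 2 = d * n%:R * k%:R by field; rewrite lt0r_neq0.
  have -> : 2 * k%:R ^+ 4 = (2 * k%:R ^+ 3) * k%:R :> R by ring.
  rewrite ler_wpM2r //.
  have : 0 <= d * n%:R by rewrite mulr_ge0 //; lra.
  lra.
have t2 : k%:R / n%:R ^+ 9 <= d * k%:R / n%:R.
  rewrite ler_pdivrMr ?exprn_gt0 //.
  have -> : d * k%:R / n%:R * n%:R ^+ 9 = d * n%:R ^+ 8 * k%:R by field; rewrite lt0r_neq0.
  rewrite -[leLHS]mul1r ler_wpM2r //.
  have : n%:R <= n%:R ^+ 8 :> R by rewrite -[leLHS]expr1 ler_weXn2l.
  by have := reg_nd; nra.
have -> : k%:R ^+ 2 / n%:R * (1 + 3 * d / k%:R) =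
   (1 + d / k%:R) * (k%:R ^+ 2 / n%:R) + (d * k%:R / n%:R + d * k%:R / n%:R).
  by field; rewrite !lt0r_neq0.
lra.
Qed.

(** The weight [t ^+ (2 * k - l - 1)] is at most [b ^+ 2 / eps ^+ 2] for [l = 1], as [t >= eps], and
    at most [b] for [2 <= l <= k / 2]. Larger [l] go to the tail. *)
Lemma sum_light (s b : R) : 0 < s <= 1 -> b = (p * s + (1 - p)) ^+ k ->
  psum (fun l => n%:R * l%:R * (pair_dom k p l ^+ (n - (2 * k - l)).-1 *
     (p * (p * s + (1 - p)) ^+ (2 * k - l).-1))) <=
  mu ^+ 2 * (4 * n%:R * p * (2 * (b ^+ 2 / eps ^+ 2) * (k%:R ^+ 2 / n%:R) +
     2 * b * (k%:R ^+ 4 / n%:R ^+ 2) + k%:R / n%:R ^+ 9)).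
Proof.
move=> s01; set t := p * s + (1 - p) => eb.
have d01 : 0 < d <= 1 by case: reg.
have [p0 e0 ep] : [/\ 0 < p, 0 < eps & eps <= 1 - p] by case: reg.
have nR : 0 < n%:R :> R by case: reg => _ _ _ _ <- *; rewrite expR_gt0.
have k400 : 400 <= k%:R :> R by rewrite ler_nat; case: reg.
have kR : 0 < k%:R :> R by lra.
have k1 : (1 < k)%N by have h : (400 <= k)%N by [case: reg]; apply: leq_trans h.
have a2 := a_le_half reg.
have w0 : 0 <= (1 - a) ^+ (2 * (n - k)) by rewrite exprn_ge0 //; lra.
have ps0 : 0 <= p * s by rewrite mulr_ge0 //; lra.
have ps1 : p * s <= p * 1 by rewrite ler_pM2l //; lra.
have te : eps <= t by rewrite /t; lra.
have t0 : 0 < t by lra.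
have t1 : t <= 1 by rewrite /t; lra.
have b0 : 0 <= b by rewrite eb exprn_ge0 // ltW.
have np0 : 0 <= 4 * n%:R * p by rewrite !mulr_ge0 // ltW.
pose tt l := t ^+ (2 * k - l).-1.
have tt0 l : 0 <= tt l by rewrite exprn_ge0 // ltW.
have tt1 l : tt l <= 1 by rewrite exprn_ile1 // ltW.
(* The factor 4 restores the missing power of [pair_dom], which is at least [1 / 4]. *)
apply: (@le_trans _ _ (psum (fun l => 4 * n%:R * p * (l%:R * tt l * phi l)))).
  apply: ler_pair_sum => l lk; rewrite -/t -/(tt l).
  have pd := pair_dom_ge reg lk.
  have e1 : (n - (2 * k - l) = (n - (2 * k - l)).-1.+1)%N by have := reg_k2n; clear -lk; lia.
  have -> : pair_dom k p l ^+ (n - (2 * k - l)) =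
      pair_dom k p l * pair_dom k p l ^+ (n - (2 * k - l)).-1 by rewrite -exprS -e1.
  set P := _ ^+ (n - _).-1.
  have P0 : 0 <= P by rewrite exprn_ge0 ?pair_dom_ge0.
  have -> : n%:R * l%:R * (P * (p * tt l)) = (n%:R * p * l%:R * tt l) * P by ring.
  have -> : 4 * n%:R * p * (l%:R * tt l * (pair_dom k p l * P)) =
     (n%:R * p * l%:R * tt l) * (4 * pair_dom k p l * P) by ring.
  apply: ler_wpM2l; first by rewrite !mulr_ge0 // ltW.
  by rewrite -[leLHS]mul1r; apply: ler_wpM2r => //; nra.
rewrite pair_sumZ mulrCA; apply: ler_wpM2l => //.
set be := b ^+ 2 / eps ^+ 2.
have be0 : 0 <= be by rewrite divr_ge0 ?sqr_ge0.
have be20 : 0 <= 2 * be by rewrite mulr_ge0.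
have b20 : 0 <= 2 * b by rewrite mulr_ge0.
set main := fun l : nat => (1 - a) ^+ (2 * (n - k)) *
   (2 * be * 'C(l, 1)%:R + 2 * b * (2 * 'C(l, 2)%:R)) : R.
have := @pair_sum_tail R 'I_n k (fun l => l%:R * tt l * phi l) main.
move=> /(_ _ _ _) h; apply: le_trans (h _ _ _) _.
- move=> l lk; apply: mulr_ge0; last by rewrite exprn_ge0 ?pair_dom_ge0.
  by rewrite mulr_ge0.
- move=> l lk; apply: mulr_ge0 => //.
  by apply: addr_ge0; apply: mulr_ge0 => //; exact: mulr_ge0.
- move=> l lk; rewrite /main bin2R bin1R.
  have h1 := pair_dom_half reg lk.
  have lt0 : 0 <= l%:R * tt l by rewrite mulr_ge0.
  apply: le_trans (ler_wpM2l lt0 h1) _.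
  rewrite mulrCA ler_wpM2l //.
  case: (leqP l 1) => l1.
    case: l l1 lk {h1 lt0} => [|[|//]] _ lk; first by rewrite !(mul0r, mulr0) addr0.
    rewrite subrr !mulr0 !mulr1 mul1r addr0.
    have : tt 1%N <= be.
      rewrite /be ler_pdivlMr ?exprn_gt0 // eb -exprM.
      apply: (@le_trans _ _ (tt 1%N * t ^+ 2)).
        by rewrite ler_wpM2l // lerXn2r ?nnegrE // ltW.
      by rewrite /tt -exprD le_eqVlt; apply/orP; left; apply/eqP; congr (_ ^+ _); clear -k1; lia.
    by have := tt0 1%N; move=> *; nra.
  have ttb : tt l <= b by rewrite eb ler_wiXn2l // ?ltW //; clear -lk k1 l1; lia.
  have l2 : 2 <= l%:R :> R by rewrite ler_nat.
  have x0 : 0 <= 2 * be * l%:R by apply: mulr_ge0.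
  have : l%:R * tt l * (1 + d / 2) <= l%:R * b * 2.
    apply: ler_pM; rewrite ?mulr_ge0 //; first by lra.
      by apply: ler_wpM2l.
    lra.
  have : 0 <= b * l%:R * (l%:R - 2) by rewrite !mulr_ge0 //; lra.
  by move=> *; nra.
apply: le_trans (lerD (psum_lin be20 b20 w0) (@tail_sum_le (fun l => l%:R * tt l) k%:R _)) _ => //.
  move=> l lk; rewrite mulr_ge0 //= -[leRHS]mulr1; apply: ler_pM => //.
  by rewrite ler_nat.
by rewrite -muE -mulrDr.
Qed.

End SecondMoments.

(** * Bad events *)

Lemma gnp_probE (R : realType) n (p : R) (A : pred {set {set 'I_n}}) :
  gnp_prob p A = bexp (pairs 'I_n) p (fun E => (A E)%:R).
Proof.
rewrite /gnp_prob /bexp big_mkcondr; apply: eq_bigr => E _.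
by case: (A E); rewrite ?mul1r ?mul0r.
Qed.

Section UnionBound.
Context {R : realType} {T : finType}.
Implicit Types (P : {set T}) (p : R).

Lemma bexp_or P p (A B : pred {set T}) : 0 <= p <= 1 ->
  bexp P p (fun E => (A E || B E)%:R) <=
  bexp P p (fun E => (A E)%:R) + bexp P p (fun E => (B E)%:R).
Proof.
move=> p01; rewrite -bexpD; apply: ler_bexp => // E _.
by case: (A E); case: (B E); rewrite /= ?addr0 ?add0r // lerDl.
Qed.

Lemma bexp_exists (I : finType) (Q : {set I}) (A : I -> pred {set T}) P p : 0 <= p <= 1 ->
  bexp P p (fun E => [exists i in Q, A i E]%:R) <=
  \sum_(i in Q) bexp P p (fun E => (A i E)%:R).
Proof.
move=> p01; rewrite -bexp_sum; apply: ler_bexp => // E _.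
case: (boolP [exists i in Q, A i E]) => [/exists_inP [i iQ Ai]|_].
  by rewrite (bigD1 i) //= Ai lerDl sumr_ge0.
by rewrite sumr_ge0.
Qed.

End UnionBound.

(** * First moment bounds and vertex degrees *)

Section FirstMoments.
Context {R : realType} {n : nat}.
Variable p : R.
Hypothesis p01 : 0 <= p <= 1.

Lemma prob_gamma_lt k : (0 < k <= n)%N ->
  bexp (pairs 'I_n) p (fun E => (gamma E < k)%N%:R) <= f n k.-1 p.
Proof.
move=> /andP[k0 kn].
have := bexp_ndom (V := 'I_n) k.-1 p; rewrite card_ord -/(f n k.-1 p) => <-.
apply: ler_bexp => // E _; case: ltnP => gk; last by rewrite sumr_ge0.
have /dominating_of_card [D Dk domD] : (gamma E <= k.-1 <= #|'I_n|)%N.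
  by rewrite card_ord; move: kn gk; clear; lia.
by rewrite /ndom (bigD1 D) //= domD lerDl sumr_ge0.
Qed.

(** A [(k - 1)]-set avoiding [v] need not dominate [v]. This drops one factor [1 - b >= 1 / 2] from
    the first moment, whence the 2. *)
Lemma prob_star_fails k (v : 'I_n) : (0 < k <= n)%N -> (1 - p) ^+ k.-1 <= 1 / 2 ->
  bexp (pairs 'I_n) p (fun E =>
    [exists D in [set D in dsets k.-1 | v \notin D]%SET, dominates_on E (~: (v |: D)) D]%:R)
  <= 2 * f n k.-1 p.
Proof.
move=> /andP[k0 kn] b2; apply: le_trans (bexp_exists _ _ _ p01) _.
set b := (1 - p) ^+ k.-1 in b2 *.
have b0 : 0 <= b by rewrite exprn_ge0 //; move: p01; lra.
apply: (@le_trans _ _ (\sum_(D in @dsets 'I_n k.-1) (1 - b) ^+ (n - k))).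
  rewrite [leRHS](bigID (fun D : {set 'I_n} => v \notin D)) /=.
  rewrite -[leLHS]addr0; apply: lerD; last by rewrite sumr_ge0 // => D _; rewrite exprn_ge0 //; lra.
  rewrite le_eqVlt; apply/orP; left; apply/eqP; apply: eq_big => D; first by rewrite inE.
  rewrite !inE => /andP[/eqP cD vD].
  rewrite prob_dominates_on ?cD.
    congr (_ ^+ _); rewrite cardsCs finset.setCK cardsU1 vD cD card_ord.
    by move: k0; clear; lia.
  rewrite -setI_eq0; apply/eqP/setP => x; rewrite !inE.
  by case: (x \in D); rewrite ?orbT ?andbF.
rewrite sumr_const card_draws card_ord -[leLHS]mulr_natl /f -/b mulrCA.
rewrite ler_wpM2l //.
have -> : (n - k.-1 = (n - k).+1)%N by move: k0 kn; clear; lia.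
rewrite exprS mulrA -[leLHS]mul1r ler_wpM2r ?exprn_ge0 //; lra.
Qed.

(** Chernoff bound with [s = expR (1 / 2) <= 2]: the generating function of the degree is at most
    [expR (p * n)], against the threshold [expR (2 * (p * n))]. *)
Lemma prob_degree_gt (v : 'I_n) :
  bexp (pairs 'I_n) p (fun E => (4 * (p * n%:R) < (degree E v)%:R)%R%:R) <=
  expR (- (p * n%:R)).
Proof.
have pp := p01; set s := expR (1 / 2 : R).
have s0 : 0 < s by exact: expR_gt0.
have s2 : s <= 2 by apply: le_trans (expR_le1D2x _) _; lra.
apply: le_trans (bexp_markov (F := fun E => s ^+ degree E v) p01 (expR_gt0 (2 * (p * n%:R))) _ _) _.
- by move=> E _; rewrite exprn_ge0 // ltW.
- move=> E _ h; rewrite /s -expRM_natr ler_expR; lra.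
rewrite bexp_expn_degree card_ord ler_pdivrMr ?expR_gt0 // -expRD.
have -> : - (p * n%:R) + 2 * (p * n%:R) = p * n%:R by ring.
apply: (@le_trans _ _ (expR p ^+ n.-1)).
  apply: lerXn2r; rewrite ?nnegrE ?expR_ge0 //.
    by apply: addr_ge0; [apply: mulr_ge0|]; lra.
  apply: le_trans (expR_ge1Dx p); nra.
rewrite -expRM_natr ler_expR; apply: ler_wpM2l; first lra.
by rewrite ler_nat leq_pred.
Qed.

End FirstMoments.

(** One event that implies all the asserted properties, so that a single failure probability has to
    be bounded. *)
Definition good_graph (R : realType) (n k : nat) (p c : R) (E : {set {set 'I_n}}) : bool :=
  [&& gamma E == k, c * (p * n%:R) <= (bondage E)%:R, (bondage E <= max_degree E)%N
    & (max_degree E)%:R <= 4 * (p * n%:R)].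

(** * Failure probability of the good event *)

Section Core.
Context {R : realType}.
Variables (n k : nat) (p L eps d s sJ J c : R).
Hypothesis reg : regime n k p L eps d.
Hypothesis fpred : f n k.-1 p <= d.
Hypothesis s01 : 0 < s <= 1.
Hypothesis sJ_gt0 : 0 < sJ.
Hypothesis J_gt0 : 0 < J.
Hypothesis c01 : 0 < c <= 1.
Hypothesis cJ : 192 * c * L <= J.
Hypothesis sJs : forall j : nat, j%:R <= J -> sJ <= s ^+ j.
Hypothesis pn2L : 2 * L <= p * n%:R.
Hypothesis light : p * n%:R *
  (4 * n%:R * p * (2 * (((p * s + (1 - p)) ^+ k) ^+ 2 / eps ^+ 2) * (k%:R ^+ 2 / n%:R) +
     2 * (p * s + (1 - p)) ^+ k * (k%:R ^+ 4 / n%:R ^+ 2) + k%:R / n%:R ^+ 9)) <= d * sJ ^+ 2.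
Implicit Types (E B : {set {set 'I_n}}).
Local Notation mu := (f n k p).
Local Notation z := (mu * k%:R / n%:R).
Local Notation T := (mu ^+ 2 * sJ ^+ 2 / (512 * c * (p * n%:R))).
Local Notation V := 'I_n.
Local Notation PE := (bexp (pairs V) p).

Let p_gt0 : 0 < p. Proof. by case: reg. Qed.
Let p01 : 0 <= p <= 1.
Proof. by case: reg => p0 e0 ep _ _ _ _ _ _ _ _ _; move: p0 e0 ep; lra. Qed.
Let d01 : 0 < d <= 1. Proof. by case: reg. Qed.
Let n_gt0 : 0 < n%:R :> R. Proof. by case: reg => _ _ _ _ <- *; rewrite expR_gt0. Qed.
Let k_gt0 : 0 < k%:R :> R.
Proof. by rewrite ltr0n; have h : (400 <= k)%N by [case: reg]; apply: leq_trans h. Qed.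
Let mu_gt0 : 0 < mu.
Proof. by case: reg => _ _ _ _ _ _ _ _ _ _ _; apply: lt_le_trans; rewrite exprn_gt0. Qed.
Let pn_gt0 : 0 < p * n%:R. Proof. exact: mulr_gt0. Qed.
Let z_gt0 : 0 < z. Proof. by rewrite divr_gt0 // mulr_gt0. Qed.
Let c_gt0 : 0 < c. Proof. by case/andP: c01. Qed.
Let T_gt0 : 0 < T.
Proof.
apply: divr_gt0; first by apply: mulr_gt0; apply: exprn_gt0.
by apply: mulr_gt0 pn_gt0; apply: mulr_gt0 c_gt0; rewrite ltr0n.
Qed.
Let kn : (0 < k <= n)%N.
Proof. by rewrite -(ltr0n R) k_gt0; have := reg_k2n reg; clear; lia. Qed.

Lemma survives E B : E \subset pairs V -> B \subset E -> #|B|%:R < c * (p * n%:R) ->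
  mu / 2 < ndom k E ->
  2 * (\sum_u (ndom_at k E u - z) ^+ 2) / z < mu / 16 ->
  \sum_v \sum_u ndom_light k s E v u ^+ 2 < T ->
  exists2 D, D \in dsets k & dominating (E :\: B) D.
Proof.
move=> EP BE Bc many var lightT.
suff : [exists D in dsets k, dominating (E :\: B) D] by move/exists_inP => [D]; exists D.
apply: contraT => /exists_inP none; exfalso.
have killed D : D \in dsets k -> ~~ dominating (E :\: B) D.
  by move=> Dk; apply/negP => domD; apply: none; exists D.
have [s0 s1] := andP s01.
(* This value makes both parts of the light term at most [mu / 16 * sJ]. Together with the two terms
   of size [mu / 16], the total is [mu / 4], below [ndom]. *)
pose lam := mu * sJ / (32 * c * (p * n%:R)).
have lam0 : 0 < lam.
  apply: divr_gt0; first exact: mulr_gt0.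
  by apply: mulr_gt0 pn_gt0; apply: mulr_gt0 c_gt0; rewrite ltr0n.
have := killed_bound BE EP (ltW s0) sJ_gt0 J_gt0 lam0 z_gt0 sJs killed.
have t1 : 2 * #|B|%:R * lam <= mu / 16 * sJ.
  apply: (@le_trans _ _ (2 * (c * (p * n%:R)) * lam)).
    by apply: ler_wpM2r; [exact: ltW | rewrite ler_pM2l // ltW].
  rewrite /lam le_eqVlt; apply/orP; left; apply/eqP.
  by field; rewrite !lt0r_neq0.
have t2 : (\sum_v \sum_u ndom_light k s E v u ^+ 2) / lam <= mu / 16 * sJ.
  rewrite ler_pdivrMr //; apply: le_trans (ltW lightT) _.
  rewrite /lam le_eqVlt; apply/orP; left; apply/eqP.
  by field; rewrite !lt0r_neq0.
have t3 : 2 * #|B|%:R * (2 * z) / J <= mu / 16.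
  rewrite ler_pdivrMr //.
  apply: (@le_trans _ _ (2 * (c * (p * n%:R)) * (2 * z))).
    by apply: ler_wpM2r; [apply: mulr_ge0 => //; exact: ltW | rewrite ler_pM2l // ltW].
  have -> : 2 * (c * (p * n%:R)) * (2 * z) = mu / 16 * (64 * c * (p * k%:R)).
    by field; rewrite lt0r_neq0.
  apply: ler_wpM2l; first by rewrite divr_ge0 // ltW.
  apply: le_trans cJ.
  have -> : 192 * c * L = 64 * c * (3 * L) by ring.
  apply: ler_wpM2l; last by case: reg.
  by rewrite mulr_ge0 // ltW.
have t12 : (2 * #|B|%:R * lam + (\sum_v \sum_u ndom_light k s E v u ^+ 2) / lam) / sJ <= mu / 8.
  by rewrite ler_pdivrMr //; lra.
have := mu_gt0; lra.
Qed.

Lemma good_of_events E (v0 : V) : E \subset pairs V ->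
  (k <= gamma E)%N ->
  ~~ [exists D in [set D in dsets k.-1 | v0 \notin D]%SET, dominates_on E (~: (v0 |: D)) D] ->
  mu / 2 < ndom k E ->
  2 * (\sum_u (ndom_at k E u - z) ^+ 2) / z < mu / 16 ->
  \sum_v \sum_u ndom_light k s E v u ^+ 2 < T ->
  (forall v, (degree E v)%:R <= 4 * (p * n%:R)) ->
  good_graph k p c E.
Proof.
move=> EP kg star many var lightT deg.
have gE : gamma E = k.
  apply/eqP; rewrite eqn_leq kg andbT.
  have /exists_inP [D Dk domD] : [exists D in dsets k, dominating E D].
    apply: contraT => /exists_inP none; exfalso.
    move: many; rewrite /ndom big1 => [|D Dk]; first by have := mu_gt0; lra.
    by case: (boolP (dominating E D)) => // domD; case: none; exists D.
  by move: Dk; rewrite inE => /eqP <-; exact: gamma_le.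
have inc : incident E v0 \subset E by apply/fintype.subsetP => e; rewrite inE => /andP[].
have gB : (gamma E < gamma (E :\: incident E v0))%N.
  rewrite gE; apply: isolating_increases_gamma => //; first by rewrite card_ord.
  move=> D Dk vD; apply: contra star => domD; apply/exists_inP; exists D => //.
  by rewrite inE Dk.
rewrite /good_graph gE eqxx /=; apply/and3P; split.
- have [B [BE gBk cB]] := bondage_witness inc gB.
  rewrite leNgt -cB; apply/negP => Bc.
  have [D Dk domD] := survives EP BE Bc many var lightT.
  have := leq_trans gBk (gamma_le domD); move: Dk; rewrite inE => /eqP ->.
  by rewrite gE ltnn.
- apply: leq_trans (bondage_le inc gB) _.
  exact: (bigop.leq_bigmax_cond (F := degree E)).
- have V0 : (0 < #|V|)%N by rewrite card_ord; case/andP: kn => k0 /(leq_trans k0).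
  by rewrite /max_degree; have [v ->] := bigop.eq_bigmax (degree E) V0.
Qed.

Lemma prob_few : PE (fun E => (ndom k E <= mu / 2)%R%:R) <= 4 * d.
Proof.
have m2 : 0 < mu ^+ 2 / 4 by rewrite divr_gt0 // exprn_gt0.
apply: le_trans (bexp_markov (F := fun E => (ndom k E - mu) ^+ 2) p01 m2 _ _) _.
- by move=> E _; rewrite sqr_ge0.
- by move=> E _ h; have := mu_gt0; nra.
rewrite ler_pdivrMr //.
rewrite (@eq_bexp _ _ _ _ _ (fun E => ndom k E ^+ 2 - 2 * mu * ndom k E + mu ^+ 2)); last first.
  by move=> E _; ring.
rewrite bexpD bexpB bexpZ bexp_cst bexp_ndom card_ord -/mu.
have := le_trans (bexp_sqr_ndom (V := V) k p01) (_ : _ <= mu ^+ 2 * (1 + d)).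
rewrite card_ord => /(_ (sum_phi reg)).
have -> : 4 * d * (mu ^+ 2 / 4) = mu ^+ 2 * d by field.
by rewrite -/mu; nra.
Qed.

Lemma prob_uneven :
  PE (fun E => (mu / 16 <= 2 * (\sum_u (ndom_at k E u - z) ^+ 2) / z)%R%:R) <= 96 * d.
Proof.
have m2 : 0 < mu / 16 by rewrite divr_gt0.
apply: le_trans (bexp_markov (F := fun E => (2 / z) * (\sum_u (ndom_at k E u - z) ^+ 2)) p01 m2 _ _) _.
- move=> E _; apply: mulr_ge0; first by rewrite divr_ge0 // ltW.
  by apply: sumr_ge0 => u _; rewrite sqr_ge0.
- by move=> E _ h; rewrite (_ : 2 / z * _ = 2 * (\sum_u (ndom_at k E u - z) ^+ 2) / z) //; exact: mulrAC.
rewrite ler_pdivrMr // bexpZ.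
rewrite (@eq_bexp _ _ _ _ _ (fun E => \sum_u ndom_at k E u ^+ 2 -
   2 * z * k%:R * ndom k E + n%:R * z ^+ 2)); last first.
  move=> E _.
  have -> : \sum_u (ndom_at k E u - z) ^+ 2 =
     \sum_u ndom_at k E u ^+ 2 - 2 * z * \sum_u ndom_at k E u + \sum_(u : V) z ^+ 2.
    rewrite mulr_sumr -sumrB -big_split; apply: eq_bigr => u _ /=; ring.
  by rewrite sum_ndom_at sumr_const card_ord mulrA -[z ^+ 2 *+ n]mulr_natl.
rewrite bexpD bexpB bexpZ bexp_cst bexp_ndom card_ord -/mu.
have := le_trans (bexp_sqr_ndom_at (V := V) k p01)
  (_ : _ <= mu ^+ 2 * (k%:R ^+ 2 / n%:R * (1 + 3 * d / k%:R))).
rewrite card_ord => /(_ (sum_l_phi reg)) h.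
set S := bexp _ _ _ in h *.
apply: (@le_trans _ _ (2 / z * (mu ^+ 2 * (k%:R ^+ 2 / n%:R * (1 + 3 * d / k%:R)) -
   2 * z * k%:R * mu + n%:R * z ^+ 2))).
  apply: ler_wpM2l; first by rewrite divr_ge0 // ltW.
  by rewrite lerD2r lerD2r.
rewrite le_eqVlt; apply/orP; left; apply/eqP; field.
by rewrite !lt0r_neq0.
Qed.

Lemma prob_light : PE (fun E => (T <= \sum_v \sum_u ndom_light k s E v u ^+ 2)%R%:R) <= 512 * d.
Proof.
apply: le_trans (bexp_markov (F := fun E => \sum_v \sum_u ndom_light k s E v u ^+ 2) p01 T_gt0 _ _) _.
- by move=> E _; apply: sumr_ge0 => v _; apply: sumr_ge0 => u _; rewrite sqr_ge0.
- by [].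
rewrite ler_pdivrMr //.
have s01' : 0 <= s <= 1 by case/andP: s01 => /ltW -> ->.
have := le_trans (bexp_sqr_ndom_light (V := V) k p01 s01') _.
rewrite card_ord => /(_ _ (sum_light reg s01 erefl)) h; apply: le_trans h _.
set M := (X in _ * X <= _); have hM : p * n%:R * M <= d * sJ ^+ 2 := light.
have -> : 512 * d * T = mu ^+ 2 * (d * sJ ^+ 2 / (c * (p * n%:R))).
  by field; rewrite !lt0r_neq0.
apply: ler_wpM2l; first exact: sqr_ge0.
rewrite ler_pdivlMr ?mulr_gt0 //; apply: le_trans hM.
have M0 : 0 <= p * n%:R * M.
  rewrite /M; have [_ e0 ep] : [/\ 0 < p, 0 < eps & eps <= 1 - p] by case: reg.
  have s0 := andP s01; have t0 : 0 <= p * s + (1 - p).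
    have : 0 <= p * s by rewrite mulr_ge0 // ltW //; case: s0.
    by move: e0 ep; lra.
  have n0 := ltW n_gt0; have p0 := ltW p_gt0.
  rewrite !mulr_ge0 // !addr_ge0 // !mulr_ge0 // ?invr_ge0 ?exprn_ge0 // ltW //.
have -> : M * (c * (p * n%:R)) = c * (p * n%:R * M) by ring.
by rewrite -[leRHS]mul1r; apply: ler_wpM2r => //; case/andP: c01.
Qed.

Lemma prob_bad : PE (fun E => (~~ good_graph k p c E)%:R) <= 1000 * d.
Proof.
have /andP[k0 kn'] := kn.
pose v0 : V := Ordinal (leq_trans k0 kn').
have nd := reg_nd reg.
have fle := fpred.
have half : (1 - p) ^+ k.-1 <= 1 / 2.
  have [e0 ep] : 0 < eps /\ eps <= 1 - p by case: reg.
  have b0 : 0 <= (1 - p) ^+ k.-1 by rewrite exprn_ge0 //; lra.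
  have := a_le_eps reg; rewrite -{1}(prednK k0) exprS; nra.
pose ev1 := fun E : {set {set V}} => (gamma E < k)%N.
pose ev2 := fun E => [exists D in [set D in dsets k.-1 | v0 \notin D]%SET, dominates_on E (~: (v0 |: D)) D].
pose ev3 := fun E : {set {set V}} => ndom k E <= mu / 2.
pose ev4 := fun E : {set {set V}} => mu / 16 <= 2 * (\sum_u (ndom_at k E u - z) ^+ 2) / z.
pose ev5 := fun E : {set {set V}} => T <= \sum_v \sum_u ndom_light k s E v u ^+ 2.
pose ev6 := fun E : {set {set V}} => [exists v in [set: V]%SET, 4 * (p * n%:R) < (degree E v)%:R].
have b1 : PE (fun E => (ev1 E)%:R) <= d by apply: le_trans (prob_gamma_lt p01 kn) fle.
have b2 : PE (fun E => (ev2 E)%:R) <= 2 * d.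
  apply: le_trans (prob_star_fails p01 v0 kn half) _; lra.
have b6 : PE (fun E => (ev6 E)%:R) <= d.
  apply: le_trans (bexp_exists _ _ _ p01) _.
  apply: (@le_trans _ _ (\sum_(v in [set: V]%SET) expR (- (p * n%:R)))).
    by apply: ler_sum => v _; exact: prob_degree_gt.
  rewrite sumr_const cardsT card_ord -[leLHS]mulr_natl.
  have eL : expR L = n%:R by case: reg.
  apply: (@le_trans _ _ (n%:R * expR (- (L * 2)))).
    by apply: ler_wpM2l; [exact: ltW | rewrite ler_expR; have := pn2L; lra].
  rewrite expRN expRM_natr eL ler_pdivrMr ?exprn_gt0 //.
  have := n_gt0; nra.
have sub E : E \subset pairs V -> ~~ good_graph k p c E ->
    [|| ev1 E, ev2 E, ev3 E, ev4 E, ev5 E | ev6 E].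
  move=> EP; apply: contraR; rewrite !negb_or => /andP[h1 /andP[h2 /and4P[h3 h4 h5 h6]]].
  apply: (good_of_events EP _ h2).
  - by rewrite leqNgt; exact: h1.
  - by rewrite ltNge; exact: h3.
  - by rewrite ltNge; exact: h4.
  - by rewrite ltNge; exact: h5.
  by move=> v; rewrite leNgt; apply: contra h6 => dv; apply/exists_inP; exists v; rewrite ?inE.
apply: (@le_trans _ _ (PE (fun E => [|| ev1 E, ev2 E, ev3 E, ev4 E, ev5 E | ev6 E]%:R))).
  apply: ler_bexp => // E EP; case: (boolP (good_graph k p c E)) => // /(sub E EP) ->.
  by [].
have := prob_few; have := prob_uneven; have := prob_light; rewrite -/(ev3 _).
move=> b5 b4 b3.
have o1 := bexp_or (pairs V) ev1 (fun E => [|| ev2 E, ev3 E, ev4 E, ev5 E | ev6 E]) p01.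
have o2 := bexp_or (pairs V) ev2 (fun E => [|| ev3 E, ev4 E, ev5 E | ev6 E]) p01.
have o3 := bexp_or (pairs V) ev3 (fun E => [|| ev4 E, ev5 E | ev6 E]) p01.
have o4 := bexp_or (pairs V) ev4 (fun E => ev5 E || ev6 E) p01.
have o5 := bexp_or (pairs V) ev5 ev6 p01.
have {}b3 : PE (fun E => (ev3 E)%:R) <= 4 * d by [].
have {}b4 : PE (fun E => (ev4 E)%:R) <= 96 * d by [].
have {}b5 : PE (fun E => (ev5 E)%:R) <= 512 * d by [].
have /andP[d0 _] := d01.
move: o1 o2 o3 o4 o5 b1 b2 b3 b4 b5 b6 d0; lra.
Qed.

End Core.

(** * The threshold r *)

Lemma bin_ge_pow n j : (j <= n)%N -> ((n - j) ^ j <= 'C(n, j) * j ^ j)%N.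
Proof.
move=> jn; apply: (@leq_trans (n ^_ j)).
  rewrite ffact_prod -[X in (_ ^ X)%N](card_ord j) -prod_nat_const.
  by apply: leq_prod => i _; rewrite leq_sub2l // ltnW.
rewrite -bin_ffact leq_mul2l -ffactnn ffact_prod; apply/orP; right.
rewrite -[X in (_ <= _ ^ X)%N](card_ord j) -prod_nat_const.
by apply: leq_prod => i _; rewrite leq_subr.
Qed.

Section FirstMomentThreshold.
Context {R : realType}.
Implicit Types (n k j : nat) (p x L eps d : R).

Lemma bernoulli_sub x n : 0 <= x <= 1 -> 1 - n%:R * x <= (1 - x) ^+ n.
Proof.
move=> x01; elim: n => [|n IH]; first by rewrite mul0r subr0.
rewrite exprS -natr1; apply: (@le_trans _ _ ((1 - x) * (1 - n%:R * x))).
  have : 0 <= n%:R * x ^+ 2 by rewrite mulr_ge0 ?sqr_ge0.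
  by rewrite expr2; lra.
by apply: ler_wpM2l => //; lra.
Qed.

Lemma expr1B_ge p eps k : 0 < eps -> 0 <= p -> eps <= 1 - p ->
  expR (- (p * k%:R / eps)) <= (1 - p) ^+ k.
Proof.
move=> e0 p0 ep.
have -> : - (p * k%:R / eps) = - (p / eps) * k%:R by ring.
rewrite expRM_natr; apply: lerXn2r; rewrite ?nnegrE ?expR_ge0 //; first lra.
rewrite expRN -[leLHS]mul1r ler_pdivrMr ?expR_gt0 //.
apply: (@le_trans _ _ ((1 - p) * (1 + p / eps))); last first.
  by apply: ler_wpM2l; [lra | exact: expR_ge1Dx].
have pe0 : 0 <= p / eps by rewrite divr_ge0 // ltW.
have : p / eps * eps = p by rewrite divfK // lt0r_neq0.
nra.
Qed.

Lemma r_minimal n p : 1 < p * n%:R ->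
  [/\ (p * n%:R)^-1 < f n (r n p) p, (r n p <= n)%N &
      forall j, (j < r n p)%N -> f n j p <= (p * n%:R)^-1].
Proof.
move=> pn1.
have fn : (p * n%:R)^-1 < f n n p.
  by rewrite /f binn subnn expr0 mulr1 invf_lt1 //; lra.
rewrite /r; case: pselect => [h|]; last by case; exists n.
case: ex_minnP => k fk kmin; split => //; first exact: kmin.
by move=> j jk; rewrite leNgt; apply/negP => /kmin; rewrite leqNgt jk.
Qed.

Lemma r_gt0 n p : 1 < p * n%:R -> (0 < r n p)%N.
Proof.
move=> pn1; have [fr _ _] := r_minimal pn1; rewrite lt0n; apply/eqP => r0.
have n0 : (0 < n)%N by case: n pn1 {fr r0} => // ; rewrite mulr0; lra.
move: fr; rewrite r0 /f bin0 expr0 subrr subn0 expr0n -leqn0 leqNgt n0 mulr0 => h.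
have : 0 < (p * n%:R)^-1 by rewrite invr_gt0; lra.
lra.
Qed.

Lemma r_upper n p L : 0 < p -> p < 1 -> expR L = n%:R -> 2 <= L -> 2 * L + 2 < p * n%:R ->
  p * (r n p)%:R <= 3 * L.
Proof.
move=> p0 p1 eL L2 pn.
have nR : 0 < n%:R :> R by rewrite -eL expR_gt0.
have n2 : 2 <= n%:R :> R by rewrite -eL; have := expR_ge1Dx L; lra.
have Lp : 0 <= 2 * L / p by rewrite divr_ge0 //; lra.
pose j := (Num.truncn (2 * L / p)).+1.
have [jle jge] : j%:R <= 2 * L / p + 1 /\ 2 * L / p < j%:R.
  have := truncn_itv Lp; rewrite -/j => /andP[h1 h2]; split => //.
  by rewrite /j -natr1 lerD2r.
have pj : 2 * L <= p * j%:R by move: jge; rewrite ltr_pdivrMr //; lra.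
have pj2 : p * j%:R <= 2 * L + 1.
  have := ler_wpM2l (ltW p0) jle; rewrite mulrDr mulrCA mulfV ?lt0r_neq0 //; lra.
have jn : (j <= n)%N.
  by rewrite -(ler_nat R) -(ler_pM2l p0); lra.
have pn1 : 1 < p * n%:R by lra.
have [_ _ rmin] := r_minimal pn1.
have rj : (r n p <= j)%N.
  rewrite leqNgt; apply/negP => /rmin.
  suff : 1 / 2 <= f n j p.
    have : (p * n%:R)^-1 < 1 / 2 by rewrite invf_plt ?posrE; lra.
    lra.
  have qj : (1 - p) ^+ j <= n%:R ^- 2.
    apply: (@le_trans _ _ (expR (- p) ^+ j)).
      by apply: lerXn2r; rewrite ?nnegrE ?expR_ge0 ?expR_ge1B //; lra.
    rewrite -expRM_natr -eL -expRM_natr -expRN ler_expR; lra.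
  have q0 : 0 <= (1 - p) ^+ j by rewrite exprn_ge0 //; lra.
  have q1 : (1 - p) ^+ j <= 1 by rewrite exprn_ile1 //; lra.
  have C1 : 1 <= 'C(n, j)%:R :> R by rewrite ler1n bin_gt0.
  have e1 : 1 / 2 <= (1 - (1 - p) ^+ j) ^+ (n - j).
    apply: le_trans (bernoulli_sub _ _); last by rewrite q0.
    have : (n - j)%:R * (1 - p) ^+ j <= n%:R * n%:R ^- 2.
      by apply: ler_pM => //; rewrite ler_nat leq_subr.
    have -> : n%:R * n%:R ^- 2 = n%:R^-1 :> R by field; rewrite lt0r_neq0.
    have : n%:R^-1 <= 1 / 2 :> R by rewrite invf_ple ?posrE //; lra.
    lra.
  by rewrite /f; nra.
have : (r n p)%:R <= j%:R :> R by rewrite ler_nat.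
by move=> /(ler_wpM2l (ltW p0)); lra.
Qed.

End FirstMomentThreshold.

Section ThresholdRegime.
Context {R : realType}.
Variables (n : nat) (p L eps d M : R).
Hypothesis p_gt0 : 0 < p.
Hypothesis eps_gt0 : 0 < eps.
Hypothesis epsp : eps <= 1 - p.
Hypothesis d01 : 0 < d <= 1.
Hypothesis expL : expR L = n%:R.
Hypothesis L40 : 40 <= L.
Hypothesis M_ge : 7000 / (d ^+ 2 * eps ^+ 2) <= M.
Hypothesis M_geX : 7 * expR (400 / eps ^+ 2) <= M.
Hypothesis big : M * L ^+ 10 * expR (eps * L) <= p ^+ 3 * n%:R.
Local Notation k := (r n p).
Hypothesis f_ge : n%:R ^+ 13 <= f n k p.
Local Notation a := ((1 - p) ^+ k).

Let n_gt0 : 0 < n%:R :> R. Proof. by rewrite -expL expR_gt0. Qed.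
Let eps_le1 : eps <= 1. Proof. by move: p_gt0 epsp; lra. Qed.
Let p_le1 : p <= 1. Proof. by move: eps_gt0 epsp; lra. Qed.
Let q_ge0 : 0 <= 1 - p. Proof. by move: p_le1; lra. Qed.
Let L_gt0 : 0 < L. Proof. by move: L40; lra. Qed.

Lemma M_ge7000 : 7000 <= M.
Proof.
apply: le_trans M_ge; have /andP[d0 d1] := d01.
have h : d ^+ 2 * eps ^+ 2 <= 1 * 1.
  by apply: ler_pM; rewrite ?sqr_ge0 // exprn_ile1 // ltW.
rewrite ler_pdivlMr ?mulr_gt0 ?exprn_gt0 //.
lra.
Qed.

Let M_gt0 : 0 < M. Proof. by have := M_ge7000; lra. Qed.
Let expeL : 1 <= expR (eps * L).
Proof. by rewrite -[leLHS]expR0 ler_expR mulr_ge0 // ltW. Qed.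

Lemma ML10_le : M * L ^+ 10 <= p ^+ 3 * n%:R.
Proof.
apply: le_trans big; rewrite -[leLHS]mulr1 ler_wpM2l //.
by rewrite mulr_ge0 ?exprn_ge0 // ltW.
Qed.

Lemma p3n_le_pn : p ^+ 3 * n%:R <= p * n%:R.
Proof.
rewrite ler_pM2r // exprS -[leRHS]mulr1 ler_pM2l // exprn_ile1 //.
exact: ltW.
Qed.

Let L_le10 : L <= L ^+ 10.
Proof. by rewrite -[leLHS]expr1 ler_weXn2l //; move: L40; lra. Qed.

Lemma pn_ge : 7000 * L <= p * n%:R.
Proof.
apply: le_trans p3n_le_pn; apply: le_trans ML10_le.
by apply: ler_pM; [exact: ler0n | exact: ltW | exact: M_ge7000 | exact: L_le10].
Qed.

Let pn_gt0 : 0 < p * n%:R. Proof. exact: mulr_gt0. Qed.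

Lemma thr_pk : p * k%:R <= 3 * L.
Proof.
have p1 : p < 1 by move: eps_gt0 epsp; lra.
apply: r_upper => //; first by move: L40; lra.
by have := pn_ge; move: L40; lra.
Qed.

Let kk_gt0 : (0 < k)%N.
Proof. by apply: r_gt0; have := pn_ge; move: L40; lra. Qed.

Let a_ge0 : 0 <= a. Proof. exact: exprn_ge0. Qed.
Let a_le1 : a <= 1. Proof. by rewrite exprn_ile1 //; move: p_gt0; lra. Qed.

Lemma thr_k3 : k%:R ^+ 3 <= n%:R :> R.
Proof.
rewrite -(ler_pM2l (exprn_gt0 3 p_gt0)) -exprMn.
apply: (@le_trans _ _ ((3 * L) ^+ 3)).
  apply: lerXn2r; rewrite ?nnegrE ?thr_pk // ?mulr_ge0 //; exact: ltW.
apply: le_trans ML10_le; rewrite exprMn.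
have L1 : 1 <= L by move: L40; lra.
apply: ler_pM; rewrite ?exprn_ge0 ?(ltW L_gt0) //.
  by have := M_ge7000; lra.
exact: ler_weXn2l.
Qed.

Lemma thr_apn_le : a * p * n%:R <= 6 * L ^+ 2.
Proof.
have pn1 : 1 < p * n%:R by have := pn_ge; move: L40; lra.
have [_ kn _] := r_minimal pn1.
have f1 : 1 <= f n k p.
  apply: le_trans f_ge; rewrite exprn_ege1 // -expL.
  by have := expR_ge1Dx L; move: L40; lra.
have a01 : 0 <= a <= 1 by rewrite a_ge0 a_le1.
have := exponent_le expL a01 f1.
rewrite natrB // => h.
have pk := thr_pk; have pn := pn_ge; have L40' := L40.
have kn2 : k%:R <= 1 / 2 * n%:R :> R by rewrite -(ler_pM2l p_gt0); lra.
have h1 : a * (1 / 2 * n%:R) <= a * (n%:R - k%:R) by apply: ler_wpM2l => //; lra.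
have h2 : p * (a * (1 / 2 * n%:R)) <= p * (k%:R * L).
  by rewrite ler_pM2l //; lra.
have h3 : p * k%:R * L <= 3 * L * L by rewrite ler_pM2r.
lra.
Qed.

Lemma thr_pk_ge : 400 / eps <= p * k%:R.
Proof.
rewrite leNgt; apply/negP => small.
have ak : expR (- (400 / eps ^+ 2)) <= a.
  apply: le_trans (expr1B_ge k eps_gt0 (ltW p_gt0) epsp).
  rewrite ler_expR lerN2 ler_pdivrMr //.
  have -> : 400 / eps ^+ 2 * eps = 400 / eps by field; rewrite lt0r_neq0.
  exact: ltW.
have h := thr_apn_le.
have pnM : M * L ^+ 10 <= p * n%:R := le_trans ML10_le p3n_le_pn.
have : expR (- (400 / eps ^+ 2)) * (7 * expR (400 / eps ^+ 2) * L ^+ 10) <= a * (p * n%:R).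
  apply: ler_pM; [exact: expR_ge0 | | exact: ak |].
    by apply: mulr_ge0; [apply: mulr_ge0; [exact: ler0n | exact: expR_ge0] | apply: exprn_ge0; exact: ltW].
  by apply: le_trans pnM; apply: ler_wpM2r; [apply: exprn_ge0; exact: ltW | exact: M_geX].
have -> : expR (- (400 / eps ^+ 2)) * (7 * expR (400 / eps ^+ 2) * L ^+ 10) = 7 * L ^+ 10.
  have : expR (- (400 / eps ^+ 2)) * expR (400 / eps ^+ 2) = 1 by rewrite -expRD addNr expR0.
  move: (expR _) (expR _) => y x xy.
  have e : x * (7 * y * L ^+ 10) = 7 * (x * y) * L ^+ 10 by ring.
  by rewrite e xy mulr1.
have : L ^+ 2 <= L ^+ 10 by apply: ler_weXn2l => //; move: L40; lra.
have : 0 < L ^+ 2 by exact: exprn_gt0.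
rewrite mulrA in h *; lra.
Qed.

Lemma thr_k400 : (400 <= k)%N.
Proof.
rewrite -(ler_nat R); apply: (@le_trans _ _ (400 / eps)).
  by rewrite ler_pdivlMr //; move: eps_le1; lra.
apply: le_trans thr_pk_ge _; rewrite -[leRHS]mul1r; exact: ler_wpM2r.
Qed.

Lemma thr_fpred : f n k.-1 p <= (p * n%:R)^-1.
Proof.
have pn1 : 1 < p * n%:R by have := pn_ge; move: L40; lra.
by have [_ _] := r_minimal pn1; apply; rewrite prednK.
Qed.

Lemma thr_fpred_d : f n k.-1 p <= d.
Proof.
apply: le_trans thr_fpred _; have /andP[d0 d1] := d01.
rewrite invf_ple ?posrE //; apply: le_trans p3n_le_pn; apply: le_trans ML10_le.
have Md : d^-1 <= M.
  apply: le_trans M_ge; rewrite ler_pdivlMr ?mulr_gt0 ?exprn_gt0 //.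
  have -> : d^-1 * (d ^+ 2 * eps ^+ 2) = d * eps ^+ 2 by field; rewrite lt0r_neq0.
  have : d * eps ^+ 2 <= 1 * 1.
    by apply: ler_pM => //; [exact: ltW | exact: sqr_ge0 | rewrite exprn_ile1 // ltW].
  lra.
have L1 : 1 <= L ^+ 10 by rewrite exprn_ege1 //; move: L40; lra.
by apply: le_trans Md _; rewrite -[leLHS]mulr1 ler_pM2l.
Qed.

Lemma thr_apn_ge : 32 * L <= a * p * n%:R.
Proof.
rewrite leNgt; apply/negP => small.
set j := k.-1; set b := (1 - p) ^+ j.
have k400 := thr_k400; have pke := thr_pk_ge; have L40' := L40.
have jk : k = j.+1 by rewrite prednK.
have kR : k%:R = j%:R + 1 :> R by rewrite jk natr1.
have k400R : 400 <= k%:R :> R by rewrite ler_nat.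
have b0 : 0 <= b by exact: exprn_ge0.
have ab : a = (1 - p) * b by rewrite {1}jk exprS.
have eb : eps * b <= a by rewrite ab ler_wpM2r.
have bpn : b * (p * n%:R) * eps <= 32 * L.
  have : eps * b * (p * n%:R) <= a * (p * n%:R) by apply: ler_wpM2r => //; exact: ltW.
  by move: small; rewrite -mulrA; lra.
have b2 : b <= 1 / 2.
  have pnM : M * L ^+ 10 * eps <= p * n%:R * eps.
    by rewrite ler_pM2r //; exact: le_trans ML10_le p3n_le_pn.
  have Me : 7000 <= M * eps.
    have : 7000 / eps ^+ 2 * eps <= M * eps.
      rewrite ler_pM2r //; apply: le_trans M_ge; rewrite ler_pdivrMr ?exprn_gt0 //.
      have -> : 7000 / (d ^+ 2 * eps ^+ 2) * eps ^+ 2 = 7000 / d ^+ 2.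
        by have /andP[d0 _] := d01; field; rewrite !lt0r_neq0.
      have /andP[d0 d1] := d01; rewrite ler_pdivlMr ?exprn_gt0 //.
      have : d ^+ 2 <= 1 by rewrite exprn_ile1 // ltW.
      lra.
    apply: le_trans.
    have -> : 7000 / eps ^+ 2 * eps = 7000 / eps by field; rewrite lt0r_neq0.
    by rewrite ler_pdivlMr //; move: eps_le1; lra.
  have h : 7000 * L <= p * n%:R * eps.
    apply: le_trans pnM; have -> : M * L ^+ 10 * eps = M * eps * L ^+ 10 by ring.
    by apply: ler_pM; [exact: ler0n | exact: ltW | exact: Me | exact: L_le10].
  have : b * (7000 * L) <= b * (p * n%:R * eps) by exact: ler_wpM2l.
  move=> h2; rewrite -(ler_pM2r L_gt0); lra.
have [kn k4] : (4 * k%:R ^+ 2 <= n%:R :> R) /\ (0 < k%:R :> R).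
  split; last by lra.
  apply: le_trans thr_k3; rewrite [leRHS]exprS; apply: ler_wpM2r; first exact: sqr_ge0.
  lra.
have fp := thr_fpred.
have pn1 : (p * n%:R)^-1 < 1.
  by rewrite invf_lt1 //; have := pn_ge; lra.
suff : 1 <= f n j p by lra.
have lower : expR (- (2 * b)) ^+ (n - j) <= (1 - b) ^+ (n - j).
  apply: lerXn2r; rewrite ?nnegrE ?expR_ge0 //; first lra.
  apply: le_trans (expR_le1B (_ : 0 <= b <= 1 / 2)); last by rewrite b0.
  by rewrite ler_expR lerN2; nra.
have jn : (j <= n)%N by rewrite -(ler_nat R); nra.
have j0 : 0 < j%:R :> R by lra.
have binlow : expR (L / 2) ^+ j <= 'C(n, j)%:R.
  rewrite -(@ler_pM2r _ (j%:R ^+ j)) ?exprn_gt0 // -exprMn.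
  apply: (@le_trans _ _ ((n - j)%:R ^+ j)); last first.
    by rewrite -!natrX -natrM ler_nat bin_ge_pow.
  apply: lerXn2r; rewrite ?nnegrE ?mulr_ge0 ?expR_ge0 //.
  rewrite natrB //; set e := expR (L / 2).
  have ee : e * e = n%:R by rewrite -expRD -expL; congr expR; field.
  have e0 : 0 < e by exact: expR_gt0.
  have : 2 * k%:R <= e.
    rewrite -(@ler_pXn2r _ 2) ?nnegrE ?mulr_ge0 ?(ltW e0) //.
    by rewrite exprMn [leRHS]expr2 ee; lra.
  nra.
rewrite /f -/b; apply: le_trans (ler_pM _ _ binlow lower); rewrite ?exprn_ge0 ?expR_ge0 //.
rewrite -!expRM_natr -expRD -[leLHS]expR0 ler_expR.
have h1 : (n - j)%:R <= n%:R :> R by rewrite ler_nat leq_subr.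
have h2 : 2 * b * (n - j)%:R <= 2 * b * n%:R by apply: ler_wpM2l => //; exact: mulr_ge0.
suff : 2 * b * n%:R <= L / 2 * j%:R by lra.
have pe0 : 0 < p * eps by exact: mulr_gt0.
rewrite -(ler_pM2r pe0).
have h3 : 400 <= p * k%:R * eps by rewrite -ler_pdivrMr.
have h4 : L * 400 <= L * (p * k%:R * eps) by apply: ler_wpM2l => //; exact: ltW.
have h5 : L * (p * eps) <= L * 1.
  apply: ler_wpM2l; first exact: ltW.
  have -> : 1 = 1 * 1 :> R by rewrite mulr1.
  by apply: ler_pM => //; exact: ltW.
have -> : 2 * b * n%:R * (p * eps) = 2 * (b * (p * n%:R) * eps) by ring.
have jE : j%:R = k%:R - 1 :> R by rewrite kR addrK.
have -> : L / 2 * j%:R * (p * eps) = (L * (p * k%:R * eps) - L * (p * eps)) / 2.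
  by rewrite jE; field.
lra.
Qed.

Lemma thr_regime : regime n k p L eps d.
Proof.
have /andP[d0 d1] := d01.
split=> //.
- exact: thr_k400.
- exact: thr_pk.
- exact: thr_apn_le.
- exact: thr_apn_ge.
have de : 0 < d ^+ 2 * eps by rewrite mulr_gt0 ?exprn_gt0.
apply: (@le_trans _ _ (d ^+ 2 * eps * (M * L ^+ 10))); last first.
  by rewrite ler_pM2l // ML10_le.
rewrite mulrA; apply: ler_wpM2r; first by rewrite exprn_ge0 // ltW.
have : 7000 <= d ^+ 2 * eps ^+ 2 * M.
  by rewrite -ler_pdivrMl ?mulr_gt0 ?exprn_gt0 // mulrC.
have : d ^+ 2 * eps ^+ 2 * M <= d ^+ 2 * eps * M.
  apply: ler_wpM2r; first exact: ltW.
  rewrite expr2 mulrA -[leRHS]mulr1; apply: ler_wpM2l => //; exact: ltW.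
lra.
Qed.

(* [12 * s = eps ^+ 2] ensures [(p * s + (1 - p)) ^+ k <= a * expR (eps / 4 * L)]. *)
Lemma thr_light s sJ : 0 < s -> 12 * s = eps ^+ 2 -> sJ = expR (- (eps / 4 * L)) ->
  p * n%:R *
  (4 * n%:R * p * (2 * (((p * s + (1 - p)) ^+ k) ^+ 2 / eps ^+ 2) * (k%:R ^+ 2 / n%:R) +
     2 * (p * s + (1 - p)) ^+ k * (k%:R ^+ 4 / n%:R ^+ 2) + k%:R / n%:R ^+ 9)) <= d * sJ ^+ 2.
Proof.
move=> s0 s12 sJE; set b := (p * s + (1 - p)) ^+ k.
have /andP[d0 d1] := d01; have L40' := L40; have ep := epsp.
set th := expR (eps / 4 * L).
have th1 : 1 <= th.
  by rewrite -[leLHS]expR0 ler_expR mulr_ge0 ?divr_ge0 // ltW.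
have y0 : 0 < p ^+ 3 * n%:R by rewrite mulr_gt0 ?exprn_gt0.
have b0 : 0 <= b by rewrite exprn_ge0 // addr_ge0 // mulr_ge0 // ltW.
have bth : b <= a * th.
  apply: (@le_trans _ _ (a * expR (p * s / eps) ^+ k)).
    rewrite -exprMn; apply: lerXn2r; rewrite ?nnegrE ?mulr_ge0 ?expR_ge0 //.
      by rewrite addr_ge0 // mulr_ge0 // ltW.
    apply: (@le_trans _ _ ((1 - p) * (1 + p * s / eps))); last first.
      by apply: ler_wpM2l => //; exact: expR_ge1Dx.
    have ps0 : 0 <= p * s / eps by rewrite divr_ge0 ?mulr_ge0 // ltW.
    have : p * s / eps * eps = p * s by rewrite divfK // lt0r_neq0.
    nra.
  apply: ler_wpM2l => //; rewrite -expRM_natr ler_expR.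
  have -> : p * s / eps * k%:R = s / eps * (p * k%:R) by ring.
  have -> : eps / 4 * L = s / eps * (3 * L).
    have -> : s = eps ^+ 2 / 12 by rewrite -s12; field.
    by field; rewrite lt0r_neq0.
  apply: ler_wpM2l; [by rewrite divr_ge0 // ltW | exact: thr_pk].
have e2 : 0 < eps ^+ 2 by rewrite exprn_gt0.
have L1 : 1 <= L by lra.
have L0 := ltW L_gt0. have p0 := ltW p_gt0. have n0 := ltW n_gt0.
have th0 : 0 <= th by lra.
have apn0 : 0 <= a * p * n%:R by rewrite !mulr_ge0.
have pk0 : 0 <= p * k%:R by rewrite mulr_ge0.
have apn := thr_apn_le; have pk := thr_pk.
rewrite -(ler_pM2r y0).
have L6 : 0 <= L ^+ 6 by exact: exprn_ge0.
have bpn0 : 0 <= b * p * n%:R by rewrite !mulr_ge0.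
have bpn : b * p * n%:R <= 6 * L ^+ 2 * th.
  apply: (@le_trans _ _ (a * p * n%:R * th)); last by apply: ler_wpM2r.
  have -> : a * p * n%:R * th = a * th * p * n%:R by ring.
  by apply: ler_wpM2r => //; apply: ler_wpM2r.
set w := th ^+ 2 / eps ^+ 2.
have thw : th <= w.
  rewrite ler_pdivlMr // (expr2 th); apply: ler_wpM2l => //.
  by apply: le_trans th1; rewrite exprn_ile1 // ltW.
have x1 : 8 * (b * p * n%:R) ^+ 2 * (p * k%:R) ^+ 2 * p / eps ^+ 2 <= 2592 * (L ^+ 6 * w).
  have -> : 2592 * (L ^+ 6 * w) = 8 * (6 * L ^+ 2 * th) ^+ 2 * (3 * L) ^+ 2 * 1 / eps ^+ 2.
    by rewrite /w; field; rewrite lt0r_neq0.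
  rewrite ler_pM2r ?invr_gt0 //.
  have z0 : 0 <= 8 * (b * p * n%:R) ^+ 2 by rewrite mulr_ge0 ?ler0n ?sqr_ge0.
  apply: ler_pM; [by rewrite mulr_ge0 ?sqr_ge0 | by [] | | by []].
  apply: ler_pM; [by [] | exact: sqr_ge0 | |].
    rewrite ler_pM2l ?ltr0n //; apply: lerXn2r; rewrite ?nnegrE //.
    exact: le_trans bpn.
  by apply: lerXn2r; rewrite ?nnegrE //; exact: le_trans pk.
have x2 : 8 * (b * p * n%:R) * (p * k%:R) ^+ 4 <= 3888 * (L ^+ 6 * w).
  apply: (@le_trans _ _ (8 * (6 * L ^+ 2 * th) * (3 * L) ^+ 4)).
    apply: ler_pM; [by rewrite mulr_ge0|by rewrite exprn_ge0|by rewrite ler_pM2l|].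
    by apply: lerXn2r => //; rewrite nnegrE; exact: le_trans pk.
  have -> : 8 * (6 * L ^+ 2 * th) * (3 * L) ^+ 4 = 3888 * (L ^+ 6 * th) by ring.
  by rewrite ler_pM2l ?ltr0n //; exact: ler_wpM2l.
have x3 : 4 * p ^+ 5 * k%:R / n%:R ^+ 6 <= 12 * (L ^+ 6 * w).
  have -> : 4 * p ^+ 5 * k%:R / n%:R ^+ 6 = 4 * (p ^+ 4 * (p * k%:R) * (n%:R ^+ 6)^-1).
    by field; rewrite lt0r_neq0.
  have n1 : 1 <= n%:R :> R by rewrite -expL; have := expR_ge1Dx L; lra.
  have i1 : (n%:R ^+ 6)^-1 <= 1 :> R by rewrite invf_le1 ?exprn_gt0 // exprn_ege1.
  have i0 : 0 <= (n%:R ^+ 6)^-1 :> R by rewrite invr_ge0 exprn_ge0.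
  have p41 : p ^+ 4 <= 1 by rewrite exprn_ile1.
  have q1 : p ^+ 4 * (p * k%:R) <= 1 * (3 * L) by apply: ler_pM => //; exact: exprn_ge0.
  have q2 : p ^+ 4 * (p * k%:R) * (n%:R ^+ 6)^-1 <= 1 * (3 * L) * 1.
    by apply: ler_pM => //; apply: mulr_ge0 => //; exact: exprn_ge0.
  have q3 : L * 1 <= L ^+ 6 * w.
    apply: ler_pM => //; first by rewrite -[leLHS]expr1 ler_weXn2l.
    exact: le_trans thw.
  lra.
apply: (@le_trans _ _ (8 * (b * p * n%:R) ^+ 2 * (p * k%:R) ^+ 2 * p / eps ^+ 2 +
  8 * (b * p * n%:R) * (p * k%:R) ^+ 4 + 4 * p ^+ 5 * k%:R / n%:R ^+ 6)).
  rewrite le_eqVlt; apply/orP; left; apply/eqP; field.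
  by rewrite !lt0r_neq0.
have w0 : 0 <= w by exact: le_trans thw.
apply: (@le_trans _ _ (7000 * (L ^+ 10 * w))).
  have : L ^+ 6 * w <= L ^+ 10 * w by apply: ler_wpM2r => //; exact: ler_weXn2l.
  have : 0 <= L ^+ 6 * w by exact: mulr_ge0.
  lra.
have thE : sJ ^+ 2 * expR (eps * L) = th ^+ 2.
  by rewrite sJE /th -!expRM_natr -expRD; congr expR; field.
apply: (@le_trans _ _ (d * sJ ^+ 2 * (M * L ^+ 10 * expR (eps * L)))); last first.
  apply: ler_wpM2l; last exact: big.
  by apply: mulr_ge0; [exact: ltW | exact: sqr_ge0].
have -> : d * sJ ^+ 2 * (M * L ^+ 10 * expR (eps * L)) = d * M * (L ^+ 10 * th ^+ 2).
  by rewrite -thE; ring.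
have dM : 7000 / eps ^+ 2 <= d * M.
  rewrite -ler_pdivrMl //; apply: le_trans M_ge.
  have -> : d^-1 * (7000 / eps ^+ 2) = 7000 / (d * eps ^+ 2) by field; rewrite !lt0r_neq0.
  apply: ler_wpM2l; first exact: ler0n.
  rewrite lef_pV2 ?posrE ?mulr_gt0 ?exprn_gt0 //; apply: ler_wpM2r; first exact: ltW.
  by rewrite expr2 -[leRHS]mulr1; apply: ler_wpM2l => //; exact: ltW.
have -> : 7000 * (L ^+ 10 * w) = 7000 / eps ^+ 2 * (L ^+ 10 * th ^+ 2).
  by rewrite /w; field; rewrite lt0r_neq0.
by apply: ler_wpM2r => //; apply: mulr_ge0; [exact: exprn_ge0 | exact: sqr_ge0].
Qed.

End ThresholdRegime.

(** * Asymptotics *)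

Section Eventually.
Context {R : realType}.

Lemma expR_ge_pow (x : R) : 0 <= x -> (x / 11) ^+ 11 <= expR x.
Proof.
move=> x0; have -> : expR x = expR (x / 11) ^+ 11.
  by rewrite -expRM_natr; congr expR; field.
apply: lerXn2r; rewrite ?nnegrE ?expR_ge0 ?divr_ge0 //.
by apply: le_trans (expR_ge1Dx _); lra.
Qed.

Lemma good_graph_whp (eps : R) : 0 < eps < 1 -> exists2 c : R, 0 < c &
  forall d : R, 0 < d <= 1 -> exists L0 : R, forall (n : nat) (p : R),
    L0 <= ln n%:R -> n%:R `^ (- 3^-1 + eps) <= p -> p <= 1 - eps ->
    n%:R ^+ 13 <= f n (r n p) p ->
    0 <= p <= 1 /\
    bexp (pairs 'I_n) p (fun E => (~~ good_graph (r n p) p c E)%:R) <= 1000 * d.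
Proof.
move=> /andP[e0 e1].
pose s := eps ^+ 2 / 12; pose t := - ln s; pose delta := eps / (4 * t).
have s0 : 0 < s by rewrite divr_gt0 ?exprn_gt0.
have s1 : s < 1 by rewrite /s ltr_pdivrMr // expr2; nra.
have t0 : 0 < t by rewrite oppr_gt0 ln_lt0 // s0.
have delta0 : 0 < delta by rewrite divr_gt0 // mulr_gt0.
exists (Num.min 1 (delta / 192)); first by rewrite lt_min ltr01 divr_gt0.
set c := Num.min _ _; have c0 : 0 < c by rewrite lt_min ltr01 divr_gt0.
move=> d d01; have /andP[d0 d1] := d01.
pose M := Num.max (7000 / (d ^+ 2 * eps ^+ 2)) (7 * expR (400 / eps ^+ 2)).
exists (Num.max 40 (M * (11 / eps) ^+ 11)) => n p; set L := ln n%:R.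
rewrite ge_max => /andP[L40 LM] pge ple fge.
have n0 : 0 < n%:R :> R.
  rewrite lt_neqAle ler0n andbT eq_sym; apply/eqP => n0.
  by move: L40; rewrite /L n0 ln0 //; lra.
have eL : expR L = n%:R by rewrite lnK.
have {}pge : expR ((- 3^-1 + eps) * L) <= p.
  by move: pge; rewrite /powR gt_eqF.
have p0 : 0 < p by apply: lt_le_trans pge; exact: expR_gt0.
have epsp : eps <= 1 - p by rewrite lerBrDl -lerBrDr.
have M1 : 7000 / (d ^+ 2 * eps ^+ 2) <= M by rewrite le_max lexx.
have M2 : 7 * expR (400 / eps ^+ 2) <= M by rewrite le_max lexx orbT.
have L0 : 0 < L by apply: lt_le_trans L40; rewrite ltr0n.
have ML : M * L ^+ 10 <= expR (eps * L).
  apply: le_trans (expR_ge_pow _); last by rewrite mulr_ge0 // ltW.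
  have -> : (eps * L / 11) ^+ 11 = (eps / 11) ^+ 11 * L * L ^+ 10 by ring.
  apply: ler_wpM2r; first by rewrite exprn_ge0 // ltW.
  apply: le_trans (ler_wpM2l _ LM); last by rewrite exprn_ge0 // divr_ge0 // ltW.
  rewrite mulrCA -exprMn.
  have -> : eps / 11 * (11 / eps) = 1 by field; rewrite lt0r_neq0.
  by rewrite expr1n mulr1.
have big : M * L ^+ 10 * expR (eps * L) <= p ^+ 3 * n%:R.
  apply: (@le_trans _ _ (expR ((- 3^-1 + eps) * L) ^+ 3 * n%:R)); last first.
    by apply: ler_wpM2r => //; apply: lerXn2r; rewrite ?nnegrE ?expR_ge0 // ltW.
  have -> : expR ((- 3^-1 + eps) * L) ^+ 3 * n%:R =
      expR (eps * L) * expR (eps * L) * expR (eps * L).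
    by rewrite -expRM_natr -eL -!expRD; congr expR; field.
  apply: ler_wpM2r; first exact: expR_ge0.
  apply: le_trans ML _; rewrite -[leLHS]mulr1; apply: ler_wpM2l; first exact: expR_ge0.
  by rewrite -[leLHS]expR0 ler_expR mulr_ge0 // ltW.
split.
  by rewrite ltW //=; apply: le_trans ple _; rewrite gerBl ltW.
have reg := thr_regime p0 e0 epsp d01 eL L40 M1 M2 big fge.
have fpred := thr_fpred_d p0 e0 epsp d01 eL L40 M1 big.
have pn := pn_ge p0 e0 epsp d01 eL L40 M1 big.
have light := thr_light p0 e0 epsp d01 eL L40 M1 big fge s0 _ erefl.
apply: (prob_bad (s := s) (sJ := expR (- (eps / 4 * L))) (J := delta * L) reg fpred).
- by rewrite s0 ltW.
- exact: expR_gt0.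
- exact: mulr_gt0.
- by rewrite c0 ge_min lexx.
- apply: ler_wpM2r; first exact: ltW.
  by rewrite mulrC -ler_pdivlMr ?ltr0n // ge_min lexx orbT.
- move=> j jJ; have -> : s = expR (- t) by rewrite opprK lnK.
  rewrite -expRM_natr ler_expR mulNr lerN2.
  apply: le_trans (ler_wpM2l (ltW t0) jJ) _.
  by rewrite /delta le_eqVlt; apply/orP; left; apply/eqP; field; rewrite lt0r_neq0.
- by apply: le_trans pn; rewrite ler_pM2r // ler_nat.
by apply: light; rewrite /s; field.
Qed.

Local Open Scope classical_set_scope.

Lemma nat_ln_ge (L0 : R) : \forall n \near \oo, L0 <= ln (n%:R : R).
Proof.
near=> n.
have h : expR L0 <= n%:R.
  by near: n; exact: nbhs_infty_ger.
by rewrite -ler_expR lnK // posrE (lt_le_trans _ h) // expR_gt0.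
Unshelve. all: by end_near.
Qed.

Lemma aas_intro (p : nat -> R) (J : set nat) (A : forall n, pred {set {set 'I_n}}) :
  (forall d : R, 0 < d <= 1 -> \forall n \near \oo, J n ->
    0 <= p n <= 1 /\ bexp (pairs 'I_n) (p n) (fun E => (~~ A n E)%:R) <= 1000 * d) ->
  aas p J A.
Proof.
move=> h; apply/cvgrPdist_le => e e0; rewrite near_withinE.
pose d := Num.min 1 (e / 1000).
have d01 : 0 < d <= 1.
  rewrite ge_min lexx andbT lt_min ltr01.
  by apply: divr_gt0; [exact: e0 | rewrite ltr0n].
apply: filterS (h d d01) => n hn Jn; have [p01 bad] := hn Jn.
rewrite gnp_probE.
have -> : 1 - bexp (pairs 'I_n) (p n) (fun E => (A n E)%:R) =
    bexp (pairs 'I_n) (p n) (fun E => (~~ A n E)%:R).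
  rewrite -{1}(bexp1 (pairs 'I_n) (p n)) -bexpB; apply: eq_bexp => E _.
  by case: (A n E); rewrite ?subrr ?subr0.
rewrite ger0_norm; last by apply: bexp_ge0 => // E _; exact: ler0n.
apply: le_trans bad _; have : d <= e / 1000 by rewrite ge_min lexx orbT.
lra.
Qed.

Lemma aas_mono (p : nat -> R) (J J' : set nat) (A B : forall n, pred {set {set 'I_n}}) :
  (forall d : R, 0 < d <= 1 -> \forall n \near \oo, J n ->
    0 <= p n <= 1 /\ bexp (pairs 'I_n) (p n) (fun E => (~~ A n E)%:R) <= 1000 * d) ->
  (forall n, J' n -> J n) -> (forall n E, A n E -> B n E) -> aas p J' B.
Proof.
move=> h sub AB; apply: aas_intro => d d01.
apply: filterS (h d d01) => n hn /sub /hn [p01 bad]; split=> //.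
apply: le_trans bad; apply: ler_bexp => // E _.
by case: (boolP (A n E)) => [/AB ->|_]; rewrite ?lexx //= ler_nat leq_b1.
Qed.

End Eventually.

Local Open Scope classical_set_scope.

Theorem theorem2p3 (R : realType) (eps : R) (p : nat -> R)
    (I' : set nat) (omega : nat -> R)
    (eps_gt0 : 0 < eps)
    (hp : \forall n \near \oo,
       n%:R `^ (- 3^-1 + eps) <= p n /\ p n <= 1 - eps)
    (I'_infinite : infinite_set I')
    (homega : omega n @[n --> \oo] --> +oo)
    (hf : forall n : nat, I' n ->
       expR (omega n * ln n%:R) <= f n (r n (p n)) (p n)) :
  aas p I' (fun n E => gamma E == r n (p n)) /\
  let I := [set n : nat | [/\ (0 < n)%N, I' n & I' n.-1]] in
  (infinite_set I ->
   aas_Theta p I (fun n E => (bondage E)%:R) (fun n E => (max_degree E)%:R) /\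
   aas_Theta p I (fun n E => (max_degree E)%:R) (fun n E => p n * n%:R)).
Proof.
have eps1 : eps < 1.
  have [N _ hN] := hp; have [h1 h2] := hN N.+1 (leqnSn N).
  have : 0 < N.+1%:R `^ (- 3^-1 + eps) by apply: powR_gt0.
  lra.
have [|c c0 good] := @good_graph_whp R eps; first by rewrite eps_gt0.
have whp (d : R) : 0 < d <= 1 -> \forall n \near \oo, I' n -> 0 <= p n <= 1 /\
   bexp (pairs 'I_n) (p n) (fun E => (~~ good_graph (r n (p n)) (p n) c E)%:R) <= 1000 * d.
  move=> d01; have [L0 hL0] := good d d01.
  near=> n => In.
  have [h1 h2] : n%:R `^ (- 3^-1 + eps) <= p n /\ p n <= 1 - eps by near: n.
  have L : Num.max L0 1 <= ln (n%:R : R) by near: n; exact: nat_ln_ge.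
  move: L; rewrite ge_max => /andP[LL0 L1].
  have om : 13 <= omega n by near: n; move/cvgryPge : homega; exact.
  apply: hL0 => //; apply: le_trans (hf n In).
  have n0 : 0 < n%:R :> R.
    rewrite lt_neqAle ler0n andbT eq_sym; apply/eqP => n0.
    by move: L1; rewrite n0 ln0 //; lra.
  rewrite -{1}(lnK n0) -expRM_natl ler_expR; apply: ler_wpM2r => //; lra.
split.
  apply: (aas_mono whp) => // n E; by case/and4P.
move=> I _.
have sub n : I n -> I' n by case.
split.
  exists (c / 4), 1; split; [by rewrite divr_gt0 | by [] |].
  apply: (aas_mono whp) => // n E /and4P[_ h1 h2 h3].
  rewrite mul1r ler_nat h2 andbT; apply: le_trans h1.
  rewrite -mulrA; apply: ler_wpM2l; first exact: ltW.
  lra.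
exists c, 4; split=> //.
apply: (aas_mono whp) => // n E /and4P[_ h1 h2 h3].
by rewrite h3 andbT; apply: le_trans h1 _; rewrite ler_nat.
Unshelve. all: by end_near.
Qed.
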